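(* Let $r\ge1$ and let $P,Q,A_1,\dots,A_r,B_1,\dots,B_s\in\mathbb{C}^{N\times N}$ be pairwise commuting matrices with $\Re(P)>0$, $\Re(Q)>0$, $\Re(A_i)>0$ for $1\le i\le r$ and $\Re(B_j)>0$ for $1\le j\le s$. Let $x>0$. Then $${}_{r}e_{s}(A_1,\dots,A_r;B_1,\dots,B_s;P,Q,z)=\Gamma^{-1}(A_1)\int_0^\infty t^{A_1-I}e^{-t}\;{}_{r-1}e_{s}(A_2,\dots,A_r;B_1,\dots,B_s;P,Q,zt)\,dt$$ and $${}_{r}E_{s}(A_1,\dots,A_r;B_1,\dots,B_s;P,Q,z)=\Gamma^{-1}(A_1)\int_0^\infty t^{A_1-I}e^{-t}\;{}_{r-1}E_{s}(A_2,\dots,A_r;B_1,\dots,B_s;P,Q,zt)\,dt.$$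
   Context: $I$ is the identity matrix in $\mathbb{C}^{N\times N}$; $t^{M}=\exp(M\ln t)$ for $t>0$; $\Re(M)>0$ means that every eigenvalue of $M$ has positive real part. For $\Re(M)>0$ and $x>0$: $\gamma(M,x)=\int_0^x u^{M-I}e^{-u}du$, $\Gamma(M,x)=\int_x^\infty u^{M-I}e^{-u}du$, $\Gamma(M)=\int_0^\infty u^{M-I}e^{-u}du$, $\Gamma^{-1}(M)=\Gamma(M)^{-1}$. Pochhammer symbol: $(M)_0=I$, $(M)_\ell=M(M+I)\cdots(M+(\ell-1)I)$. The generalized incomplete exponential matrix functions (the dependence on the fixed $x>0$ being suppressed in the notation) are $${}_re_s(A_1,\dots,A_r;B_1,\dots,B_s;P,Q,z)=\sum_{\ell=0}^\infty \frac{z^\ell}{\ell!}\prod_{i=1}^r(A_i)_\ell\Big[\prod_{j=1}^s(B_j)_\ell\Big]^{-1}\gamma(\ell P+Q,x)\Gamma^{-1}(\ell P+Q),$$ $${}_rE_s(A_1,\dots,A_r;B_1,\dots,B_s;P,Q,z)=\sum_{\ell=0}^\infty \frac{z^\ell}{\ell!}\prod_{i=1}^r(A_i)_\ell\Big[\prod_{j=1}^s(B_j)_\ell\Big]^{-1}\Gamma(\ell P+Q,x)\Gamma^{-1}(\ell P+Q).$$ Empty products equal $I$. The identities are understood for those $z\in\mathbb{C}$ for which the series and integrals involved converge. *)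

(* Defs.v *)
From HB Require Import structures.
From mathcomp Require Import all_boot all_order all_algebra.
From mathcomp Require Import all_classical all_reals all_analysis.
From mathcomp Require Import complex.

Set Implicit Arguments.
Unset Strict Implicit.
Unset Printing Implicit Defensive.

Import Order.TTheory GRing.Theory Num.Theory.
Import numFieldNormedType.Exports.

Local Open Scope classical_set_scope.
Local Open Scope ring_scope.

(* R[i] packaged as an element of numClosedFieldType: the topologies of
   numFieldNormedType are then found on Cplx R and on 'M[Cplx R]_N (they are
   not found by unification on R[i] itself). *)
Definition Cplx (R : realType) : numClosedFieldType := R[i]%C.

Definition RtoC (R : realType) (t : R) : Cplx R := (t%:C)%C.

Section MatrixFunctions.
Variables (R : realType) (N : nat).
Local Notation C := (Cplx R).
Local Notation mu := (@lebesgue_measure R).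

Definition Re_pos (M : 'M[C]_N) : Prop :=
  forall a : C, eigenvalue M a -> 0 < complex.Re a.

Definition expmx (M : 'M[C]_N) : 'M[C]_N :=
  limn (series (fun k => (k`!%:R)^-1 *: M ^+ k)).

(* Only used for t > 0 (ln is 0 on nonpositive reals). *)
Definition powmx (t : R) (M : 'M[C]_N) : 'M[C]_N := expmx (RtoC (ln t) *: M).

(* Lebesgue integrals of matrix-valued functions are taken entrywise, on the
   real and imaginary parts. *)
Definition mx_integrable (D : set R) (F : R -> 'M[C]_N) : Prop :=
  forall i j, mu.-integrable D (EFin \o (fun t => complex.Re (F t i j))) /\
              mu.-integrable D (EFin \o (fun t => complex.Im (F t i j))).

Definition mx_integral (D : set R) (F : R -> 'M[C]_N) : 'M[C]_N :=
  \matrix_(i, j) Complex (\int[mu]_(t in D) complex.Re (F t i j))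
                         (\int[mu]_(t in D) complex.Im (F t i j)).

(* Integrals from a to infinity are improper at infinity, so that conditional
   convergence there is allowed. *)
Definition cvg_integral_pinfty (a : R) (F : R -> 'M[C]_N) : Prop :=
  (forall T : R, mx_integrable `]a, T] F) /\
  cvg (mx_integral `]a, T] F @[T --> +oo%R]).

Definition integral_pinfty (a : R) (F : R -> 'M[C]_N) : 'M[C]_N :=
  lim (mx_integral `]a, T] F @[T --> +oo%R]).

Definition gamma_kernel (M : 'M[C]_N) (u : R) : 'M[C]_N :=
  RtoC (expR (- u)) *: powmx u (M - 1%:M).

Definition lower_gamma (M : 'M[C]_N) (x : R) : 'M[C]_N :=
  mx_integral `]0, x] (gamma_kernel M).

Definition upper_gamma (M : 'M[C]_N) (x : R) : 'M[C]_N :=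
  integral_pinfty x (gamma_kernel M).

Definition Gamma (M : 'M[C]_N) : 'M[C]_N :=
  integral_pinfty 0 (gamma_kernel M).

Definition poch (M : 'M[C]_N) (l : nat) : 'M[C]_N :=
  \prod_(k < l) (M + (k%:R)%:M).

Section IncompleteExponential.
Variables (r s : nat) (A : 'I_r -> 'M[C]_N) (B : 'I_s -> 'M[C]_N).
Variables (P Q : 'M[C]_N) (x : R) (z : C).

Definition hyp_coef (l : nat) : 'M[C]_N :=
  (z ^+ l / l`!%:R) *:
    (\prod_(i < r) poch (A i) l *m invmx (\prod_(j < s) poch (B j) l)).

Definition e_term (l : nat) : 'M[C]_N :=
  let M := l%:R *: P + Q in
  hyp_coef l *m lower_gamma M x *m invmx (Gamma M).

Definition E_term (l : nat) : 'M[C]_N :=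
  let M := l%:R *: P + Q in
  hyp_coef l *m upper_gamma M x *m invmx (Gamma M).

Definition inc_e : 'M[C]_N := limn (series e_term).

Definition inc_E : 'M[C]_N := limn (series E_term).

End IncompleteExponential.
End MatrixFunctions.

(* A_2, ..., A_r as a family, for the family A_1, ..., A_r. *)
Definition tail_family (T : Type) (r : nat) (A : 'I_r.+1 -> T) : 'I_r -> T :=
  fun i => A (lift ord0 i).

(* Main.v *)
(* Write A for A_1 and D_l for the l-th term of the series of order r - 1 at z.
   The l-th term of the series of order r is c_l = (A)_l D_l, and the integrand is
   t^(A-I) e^(-t) sum_l t^l D_l; the D_l are arbitrary matrices as far as the
   argument is concerned.
   Since c_l is bounded, D_l = O((1 + q)^l / l!) for every q > 0. Hence, after
   insertion of a factor e^(-dt) with d > 0, sum and integral can be exchanged by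
   dominated convergence, and integration by parts evaluates the moments:
     int t^l e^(-(1+d)t) t^(A-I) dt = (1 + d)^(-l) (A)_l G(d),
   where G(d) is the moment of order 0. The regularized integral is therefore
   G(d) sum_l (1 + d)^(-l) c_l. As d tends to 0, Abel's theorem for series applies
   to the sum, and Abel's theorem for improper integrals applies to the regularized
   integral and to G(d), which tends to Gamma(A).
   Gamma(A) is invertible: a matrix W with W Gamma(A) = 0 kills every moment
   int t^n e^(-t) t^(A-I) dt, whereas these moments, normalized by n^A and (n-1)!,
   tend to the identity by the law of large numbers for the Gamma distribution.
   Integrability at 0 comes from t^A = O(t^eps), a consequence of the
   Cayley-Hamilton theorem and of Re(A) > 0. *)
Require Import Defs.
From HB Require Import structures.
From mathcomp Require Import all_boot all_order all_algebra.
From mathcomp Require Import all_classical all_reals all_analysis.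
From mathcomp Require Import complex measurable_realfun ring lra.

Set Implicit Arguments.
Unset Strict Implicit.
Unset Printing Implicit Defensive.

Import Order.TTheory GRing.Theory Num.Theory.
Import numFieldNormedType.Exports.

Local Open Scope classical_set_scope.
Local Open Scope ring_scope.

(** * Norm and convergence of complex matrices *)

Section MatrixNorm.
Variables (R : realType) (N : nat).
Local Notation C := (Cplx R).
Implicit Types (a b : C) (M W : 'M[C]_N).

(** The series and the integral may both converge only conditionally, which forbids a direct
    exchange. Convergence of the sum of the c_l yields no more than their boundedness, hence a
    growth of order e^((1+q)t) for the sum of t^l D_l, which e^(-t) just fails to control. Against
    the extra factor e^(-dt) the choice q = d/2 leaves the integrable e^(-(d/2)t). Invertibility of
    Gamma(A) could be drawn from the absence of zeros of the scalar Gamma function and spectral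
    mapping. The moments give it from real estimates alone: with k a natural number above the norm
    of A, the deviation of (t/n)^A from the identity is controlled by (t/n)^k and (t/n)^(-k), whose
    means are finite products by the recursion of Gamma. The two identities differ only in a right
    factor of D_l, so one transform formula yields both. *)

Definition cnorm1 (a : C) : R := `|complex.Re a| + `|complex.Im a|.

(* The library norm of a complex matrix takes its values in the complex numbers
   and is not submultiplicative; this one is real and submultiplicative. *)
Definition mxnorm1 M : R := \sum_i \sum_j cnorm1 (M i j).

Lemma Cplx_ReD a b : complex.Re (a + b) = complex.Re a + complex.Re b.
Proof. by case: a b => ? ? []. Qed.

Lemma Cplx_ImD a b : complex.Im (a + b) = complex.Im a + complex.Im b.
Proof. by case: a b => ? ? []. Qed.

Lemma Cplx_ReN a : complex.Re (- a) = - complex.Re a.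
Proof. by case: a. Qed.

Lemma Cplx_ImN a : complex.Im (- a) = - complex.Im a.
Proof. by case: a. Qed.

Lemma Cplx_ReM a b : complex.Re (a * b) =
  complex.Re a * complex.Re b - complex.Im a * complex.Im b.
Proof. by case: a b => ? ? []. Qed.

Lemma Cplx_ImM a b : complex.Im (a * b) =
  complex.Re a * complex.Im b + complex.Im a * complex.Re b.
Proof. by case: a b => ? ? []. Qed.

Lemma Cplx_ext a b : complex.Re a = complex.Re b -> complex.Im a = complex.Im b -> a = b.
Proof. by case: a b => ? ? [? ?] /= -> ->. Qed.

Lemma Cplx_Re_sum I (r : seq I) (P : pred I) (F : I -> C) :
  complex.Re (\sum_(i <- r | P i) F i) = \sum_(i <- r | P i) complex.Re (F i).
Proof. exact: (big_morph (fun a : C => complex.Re a) Cplx_ReD). Qed.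

Lemma Cplx_Im_sum I (r : seq I) (P : pred I) (F : I -> C) :
  complex.Im (\sum_(i <- r | P i) F i) = \sum_(i <- r | P i) complex.Im (F i).
Proof. exact: (big_morph (fun a : C => complex.Im a) Cplx_ImD). Qed.

Lemma cnorm1_ge0 a : 0 <= cnorm1 a.
Proof. by rewrite addr_ge0. Qed.

Lemma cnorm1_0 : cnorm1 0 = 0.
Proof. by rewrite /cnorm1 normr0 addr0. Qed.

Lemma cnorm1_eq0 a : cnorm1 a = 0 -> a = 0.
Proof.
move=> /eqP; rewrite paddr_eq0// !normr_eq0 => /andP[/eqP ? /eqP ?].
exact: Cplx_ext.
Qed.

Lemma cnorm1D a b : cnorm1 (a + b) <= cnorm1 a + cnorm1 b.
Proof.
rewrite /cnorm1 Cplx_ReD Cplx_ImD addrACA.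
by apply: lerD; exact: ler_normD.
Qed.

Lemma cnorm1N a : cnorm1 (- a) = cnorm1 a.
Proof. by rewrite /cnorm1 Cplx_ReN Cplx_ImN !normrN. Qed.

Lemma cnorm1M a b : cnorm1 (a * b) <= cnorm1 a * cnorm1 b.
Proof.
rewrite /cnorm1 Cplx_ReM Cplx_ImM mulrDl !mulrDr -!normrM.
rewrite [leRHS](_ : _ = (`|complex.Re a * complex.Re b| + `|complex.Im a * complex.Im b|)
 + (`|complex.Re a * complex.Im b| + `|complex.Im a * complex.Re b|)); last first.
  by ring.
by apply: lerD; [exact: ler_normB | exact: ler_normD].
Qed.

Lemma cnorm1_sum I (r : seq I) (P : pred I) (F : I -> C) :
  cnorm1 (\sum_(i <- r | P i) F i) <= \sum_(i <- r | P i) cnorm1 (F i).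
Proof.
elim/big_ind2 : _ => //; first by rewrite cnorm1_0.
by move=> x1 x2 y1 y2 h1 h2; apply: (le_trans (cnorm1D _ _)); exact: lerD.
Qed.

Lemma mxnorm1_ge0 M : 0 <= mxnorm1 M.
Proof. by do 2!apply: sumr_ge0 => ? _; exact: cnorm1_ge0. Qed.

Lemma cnorm1_le_mxnorm1 M i j : cnorm1 (M i j) <= mxnorm1 M.
Proof.
rewrite /mxnorm1 (bigD1 i)//= (bigD1 j)//= -addrA lerDl addr_ge0//.
  by apply: sumr_ge0 => ? _; exact: cnorm1_ge0.
by do 2!apply: sumr_ge0 => ? _; exact: cnorm1_ge0.
Qed.

Lemma normRe_le_mxnorm1 M i j : `|complex.Re (M i j)| <= mxnorm1 M.
Proof. by apply: le_trans (cnorm1_le_mxnorm1 M i j); rewrite lerDl. Qed.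

Lemma normIm_le_mxnorm1 M i j : `|complex.Im (M i j)| <= mxnorm1 M.
Proof. by apply: le_trans (cnorm1_le_mxnorm1 M i j); rewrite lerDr. Qed.

Lemma mxnorm1_0 : mxnorm1 0 = 0.
Proof. by rewrite /mxnorm1 big1// => i _; rewrite big1// => j _; rewrite mxE cnorm1_0. Qed.

Lemma mxnorm1_eq0 M : mxnorm1 M = 0 -> M = 0.
Proof.
move=> M0; apply/matrixP => i j; rewrite mxE; apply: cnorm1_eq0.
by apply/eqP; rewrite eq_le cnorm1_ge0 andbT -M0 cnorm1_le_mxnorm1.
Qed.

Lemma mxnorm1D M W : mxnorm1 (M + W) <= mxnorm1 M + mxnorm1 W.
Proof.
rewrite /mxnorm1 -big_split/=; apply: ler_sum => i _.
by rewrite -big_split/=; apply: ler_sum => j _; rewrite mxE; exact: cnorm1D.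
Qed.

Lemma mxnorm1N M : mxnorm1 (- M) = mxnorm1 M.
Proof. by do 2!apply: eq_bigr => ? _; rewrite mxE cnorm1N. Qed.

Lemma mxnorm1B M W : mxnorm1 (M - W) <= mxnorm1 M + mxnorm1 W.
Proof. by rewrite -(mxnorm1N W) mxnorm1D. Qed.

Lemma mxnorm1_sum I (r : seq I) (P : pred I) (F : I -> 'M[C]_N) :
  mxnorm1 (\sum_(i <- r | P i) F i) <= \sum_(i <- r | P i) mxnorm1 (F i).
Proof.
elim/big_ind2 : _ => //; first by rewrite mxnorm1_0.
by move=> x1 x2 y1 y2 h1 h2; apply: (le_trans (mxnorm1D _ _)); exact: lerD.
Qed.

Lemma RtoC_Re (t : R) a : complex.Re (RtoC t * a) = t * complex.Re a.
Proof. by rewrite Cplx_ReM /= mul0r subr0. Qed.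

Lemma RtoC_Im (t : R) a : complex.Im (RtoC t * a) = t * complex.Im a.
Proof. by rewrite Cplx_ImM /= mul0r addr0. Qed.

Lemma mxnorm1ZR (t : R) M : mxnorm1 (RtoC t *: M) = `|t| * mxnorm1 M.
Proof.
rewrite /mxnorm1 mulr_sumr; apply: eq_bigr => i _.
rewrite mulr_sumr; apply: eq_bigr => j _.
by rewrite mxE /cnorm1 RtoC_Re RtoC_Im !normrM mulrDr.
Qed.

Lemma mxnorm1M M W : mxnorm1 (M *m W) <= mxnorm1 M * mxnorm1 W.
Proof.
rewrite /mxnorm1 mulr_suml; apply: ler_sum => i _.
apply: (@le_trans _ _ (\sum_j \sum_k cnorm1 (M i k) * cnorm1 (W k j))).
  apply: ler_sum => j _; rewrite mxE; apply: (le_trans (cnorm1_sum _ _ _)).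
  by apply: ler_sum => k _; exact: cnorm1M.
rewrite exchange_big/= mulr_suml; apply: ler_sum => k _.
rewrite -mulr_sumr ler_wpM2l ?cnorm1_ge0//.
rewrite [leRHS](bigD1 k)//= lerDl; apply: sumr_ge0 => l _.
by apply: sumr_ge0 => ? _; exact: cnorm1_ge0.
Qed.

Lemma RtoC_norm_le a (e : R) : 0 <= e -> cnorm1 a <= e -> `|a| <= RtoC e.
Proof.
move=> e0 ae; rewrite [`|a|]normc_def lecR.
apply: le_trans ae.
rewrite -(@ler_pXn2r _ 2)// ?nnegrE ?sqrtr_ge0 ?cnorm1_ge0//.
rewrite sqr_sqrtr ?addr_ge0 ?sqr_ge0// /cnorm1 sqrrD !real_normK ?num_real//.
by rewrite addrAC lerDl mulrn_wge0// mulr_ge0.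
Qed.

Lemma cnorm1_le a (e : R) : `|a| <= RtoC e -> cnorm1 a <= 2 * e.
Proof.
have -> : `|a| = RtoC (Num.sqrt (complex.Re a ^+ 2 + complex.Im a ^+ 2)).
  by rewrite [`|a|]normc_def.
rewrite lecR => ae.
rewrite /cnorm1 mulr_natl mulr2n; apply: lerD; apply: le_trans ae;
  rewrite -sqrtr_sqr ler_sqrt ?addr_ge0 ?sqr_ge0//.
- by rewrite lerDl sqr_ge0.
- by rewrite lerDr sqr_ge0.
Qed.

Lemma sum_ord2_const (c : R) : \sum_(i < N) \sum_(j < N) c = (N * N)%:R * c.
Proof. by rewrite !sumr_const card_ord -mulrnA -[LHS]mulr_natl. Qed.

(** The library topology comes from entrywise balls whose radius is a positive element of the
    complex numbers. Such a radius is real ([eE]), which allows the passage to the real norm in both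
    directions. *)
Lemma mx_cvgP (T : Type) (F : set_system T) {FF : Filter F} (f : T -> 'M[C]_N) M :
  f @ F --> M <-> mxnorm1 (f t - M) @[t --> F] --> 0.
Proof.
split.
- move=> fM; apply/cvgrPdist_lt => e e0.
  (* The factor 2 is the loss between modulus and [cnorm1]. The successor makes the sum over the N *
     N entries strictly smaller than [e], and keeps [d] meaningful for N = 0. *)
  pose d := e / (2 * (N * N).+1%:R).
  have d0 : 0 < d by rewrite divr_gt0// mulr_gt0.
  have d'0 : 0 < RtoC d by rewrite ltcR.
  move/cvg_ballP : fM => /(_ _ d'0).
  apply: filterS => t [_ Ht].
  rewrite sub0r normrN ger0_norm ?mxnorm1_ge0//.
  apply: (@le_lt_trans _ _ (\sum_(i < N) \sum_(j < N) 2 * d)).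
    apply: ler_sum => i _; apply: ler_sum => j _; rewrite !mxE.
    by have := Ht i j; rewrite /ball/= distrC => /ltW/cnorm1_le.
  have u0 : (N * N).+1%:R != 0 :> R by rewrite pnatr_eq0.
  have -> : \sum_(i < N) \sum_(j < N) 2 * d = e * ((N * N)%:R / (N * N).+1%:R).
    by rewrite sum_ord2_const /d; field.
  by rewrite gtr_pMr// ltr_pdivrMr// mul1r ltr_nat.
- move=> fM; apply/cvg_ballP => e e0.
  have eE : e = RtoC (complex.Re e).
    by move: e0; rewrite ltcE /= => /andP[/eqP h _]; apply: Cplx_ext.
  have e'0 : 0 < complex.Re e by move: e0; rewrite eE ltcR.
  move/cvgrPdist_lt : fM => /(_ _ e'0); apply: filterS => t.
  rewrite sub0r normrN ger0_norm ?mxnorm1_ge0// => h.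
  split=> // i j.
  rewrite /ball/= distrC eE.
  apply: le_lt_trans (RtoC_norm_le (mxnorm1_ge0 (f t - M)) _) _.
    by have := cnorm1_le_mxnorm1 (f t - M) i j; rewrite !mxE.
  by rewrite ltcR.
Qed.

Lemma mx_cvg_coordP (T : Type) (F : set_system T) {FF : Filter F} (f : T -> 'M[C]_N) M :
  f @ F --> M <-> forall i j,
    complex.Re (f t i j) @[t --> F] --> complex.Re (M i j) /\
    complex.Im (f t i j) @[t --> F] --> complex.Im (M i j).
Proof.
rewrite mx_cvgP; split.
- move=> /cvgr0Pnorm_le fM i j; split; apply/cvgrPdist_le => e e0;
    apply: filterS (fM _ e0) => t; rewrite ger0_norm ?mxnorm1_ge0// => fMe.
  + apply: le_trans (le_trans (normRe_le_mxnorm1 (f t - M) i j) fMe).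
    by rewrite !mxE Cplx_ReD Cplx_ReN distrC.
  + apply: le_trans (le_trans (normIm_le_mxnorm1 (f t - M) i j) fMe).
    by rewrite !mxE Cplx_ImD Cplx_ImN distrC.
- move=> fM.
  have -> : (0 : R) = \sum_(i < N) \sum_(j < N) (`|0 : R| + `|0 : R|).
    by rewrite big1// => i _; rewrite big1// => j _; rewrite normr0 addr0.
  have addc (x : R * R) : {for x, continuous (fun y : R * R => y.1 + y.2)}.
    exact: add_continuous.
  apply: (cvg_big addc) => i _; apply: (cvg_big addc) => j _.
  have [fRe fIm] := fM i j.
  apply: cvgD; apply: cvg_norm.
  + rewrite -(subrr (complex.Re (M i j))).
    under eq_fun do rewrite !mxE Cplx_ReD Cplx_ReN.
    by apply: cvgB => //; exact: cvg_cst.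
  + rewrite -(subrr (complex.Im (M i j))).
    under eq_fun do rewrite !mxE Cplx_ImD Cplx_ImN.
    by apply: cvgB => //; exact: cvg_cst.
Qed.

End MatrixNorm.

(** * Real coordinates: limits, series and derivatives of matrix functions *)

Section MatrixCoord.
Variables (R : realType) (N : nat).
Local Notation C := (Cplx R).
Implicit Types (M W : 'M[C]_N).

(* [b = true] selects the real part, [b = false] the imaginary part. *)
Definition mxcoord (b : bool) (i j : 'I_N) M : R :=
  if b then complex.Re (M i j) else complex.Im (M i j).

Lemma mxcoord_ext M W : (forall b i j, mxcoord b i j M = mxcoord b i j W) -> M = W.
Proof.
move=> MW; apply/matrixP => i j; apply: Cplx_ext.
- exact: (MW true).
- exact: (MW false).
Qed.

Lemma mxcoordD b i j M W : mxcoord b i j (M + W) = mxcoord b i j M + mxcoord b i j W.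
Proof. by case: b; rewrite /mxcoord mxE ?Cplx_ReD ?Cplx_ImD. Qed.

Lemma mxcoord0 b i j : mxcoord b i j 0 = 0.
Proof. by case: b; rewrite /mxcoord mxE. Qed.

Lemma mxcoordZ b i j (t : R) M : mxcoord b i j (RtoC t *: M) = t * mxcoord b i j M.
Proof. by case: b; rewrite /mxcoord mxE ?RtoC_Re ?RtoC_Im. Qed.

Lemma mxcoord_sum b i j I (r : seq I) (P : pred I) (F : I -> 'M[C]_N) :
  mxcoord b i j (\sum_(k <- r | P k) F k) = \sum_(k <- r | P k) mxcoord b i j (F k).
Proof. exact: (big_morph (mxcoord b i j) (mxcoordD b i j) (mxcoord0 b i j)). Qed.

(** One formula for both parts of a complex product: the sign (-1)^b is -1 exactly for the real
    part, and [~~ b] exchanges the parts in the second summand. *)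
Lemma mxcoordM b i j M W : mxcoord b i j (M *m W) =
  \sum_k (mxcoord true i k M * mxcoord b k j W
          + (-1) ^+ b * mxcoord false i k M * mxcoord (~~ b) k j W).
Proof.
case: b; rewrite /mxcoord mxE ?Cplx_Re_sum ?Cplx_Im_sum; apply: eq_bigr => k _.
- by rewrite Cplx_ReM expr1 mulN1r mulNr.
- by rewrite Cplx_ImM expr0 mul1r.
Qed.

Lemma normr_mxcoord b i j M : `|mxcoord b i j M| <= mxnorm1 M.
Proof. by case: b; [exact: normRe_le_mxnorm1|exact: normIm_le_mxnorm1]. Qed.

Lemma mxnorm1_coord_le M (e : R) : 0 <= e -> (forall b i j, `|mxcoord b i j M| <= e) ->
  mxnorm1 M <= 2 * (N * N)%:R * e.
Proof.
move=> e0 Me; apply: (@le_trans _ _ (\sum_(i < N) \sum_(j < N) (e + e))).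
  apply: ler_sum => i _; apply: ler_sum => j _; apply: lerD.
  - exact: (Me true).
  - exact: (Me false).
rewrite sum_ord2_const; lra.
Qed.

Lemma mx_cvg_coord (T : Type) (F : set_system T) {FF : Filter F} (f : T -> 'M[C]_N) M :
  f @ F --> M <->
  forall b i j, mxcoord b i j (f t) @[t --> F] --> mxcoord b i j M.
Proof.
rewrite mx_cvg_coordP; split=> [fM [] i j|fM i j].
- by have [] := fM i j.
- by have [] := fM i j.
- by split; [exact: (fM true)|exact: (fM false)].
Qed.

Lemma mx_cvgZ (T : Type) (F : set_system T) {FF : Filter F} (f : T -> R) (G : T -> 'M[C]_N)
    (a : R) M : f @ F --> a -> G @ F --> M -> RtoC (f x) *: G x @[x --> F] --> RtoC a *: M.
Proof.
move=> fa /mx_cvg_coord GM; apply/mx_cvg_coord => b i j.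
rewrite mxcoordZ; under eq_fun do rewrite mxcoordZ.
by apply: cvgM.
Qed.

Lemma mx_cvgD (T : Type) (F : set_system T) {FF : Filter F} (f g : T -> 'M[C]_N) M W :
  f @ F --> M -> g @ F --> W -> f x + g x @[x --> F] --> M + W.
Proof.
move=> /mx_cvg_coord fM /mx_cvg_coord gW; apply/mx_cvg_coord => b i j.
rewrite mxcoordD; under eq_fun do rewrite mxcoordD.
by apply: cvgD.
Qed.

Lemma mx_squeeze0 (f : nat -> 'M[C]_N) (u : nat -> R) :
  (forall n, mxnorm1 (f n) <= u n) -> u n @[n --> \oo] --> 0 -> f n @[n --> \oo] --> (0 : 'M[C]_N).
Proof.
move=> fu u0; apply/mx_cvgP; apply: (@squeeze_cvgr _ _ _ _ (fun=> 0) u) => //.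
- by apply: nearW => n; rewrite subr0 mxnorm1_ge0 fu.
- exact: cvg_cst.
Qed.

Lemma mx_cvgM (T : Type) (F : set_system T) {FF : Filter F} (f g : T -> 'M[C]_N) M W :
  f @ F --> M -> g @ F --> W -> f x *m g x @[x --> F] --> M *m W.
Proof.
move=> /mx_cvg_coord fM /mx_cvg_coord gW; apply/mx_cvg_coord => b i j.
rewrite mxcoordM; under eq_fun do rewrite mxcoordM.
have addc (x : R * R) : {for x, continuous (fun y : R * R => y.1 + y.2)}.
  exact: add_continuous.
apply: (cvg_big addc) => k _; apply: cvgD; apply: cvgM; [exact: fM|exact: gW| |exact: gW].
by apply: cvgMr; exact: fM.
Qed.

Lemma mx_cvg_mull (T : Type) (F : set_system T) {FF : Filter F} (f : T -> 'M[C]_N) M W :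
  f @ F --> M -> W *m f t @[t --> F] --> W *m M.
Proof.
rewrite !mx_cvgP => fM; apply: (@squeeze_cvgr _ _ _ _ (fun=> 0)
   (fun t => mxnorm1 W * mxnorm1 (f t - M))).
- by apply: nearW => t; rewrite mxnorm1_ge0/= -mulmxBr mxnorm1M.
- exact: cvg_cst.
- by rewrite -(mulr0 (mxnorm1 W)); apply: cvgMr.
Qed.

Lemma mx_cvg_mulr (T : Type) (F : set_system T) {FF : Filter F} (f : T -> 'M[C]_N) M W :
  f @ F --> M -> f t *m W @[t --> F] --> M *m W.
Proof.
rewrite !mx_cvgP => fM; apply: (@squeeze_cvgr _ _ _ _ (fun=> 0)
   (fun t => mxnorm1 (f t - M) * mxnorm1 W)).
- by apply: nearW => t; rewrite mxnorm1_ge0/= -mulmxBl mxnorm1M.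
- exact: cvg_cst.
- by rewrite -(mul0r (mxnorm1 W)); apply: cvgMl.
Qed.

Lemma mx_cvg_lim (T : Type) (F : set_system T) {FF : ProperFilter F} (f : T -> 'M[C]_N) M :
  f @ F --> M -> lim (f @ F) = M.
Proof. by move=> fM; apply: cvg_lim fM; exact: norm_hausdorff. Qed.

Lemma mx_cvg_unique (T : Type) (F : set_system T) {FF : ProperFilter F} (f : T -> 'M[C]_N) M W :
  f @ F --> M -> f @ F --> W -> M = W.
Proof. by move=> /mx_cvg_lim <- /mx_cvg_lim <-. Qed.

Lemma mx_cvg_norm_le (T : Type) (F : set_system T) {FF : ProperFilter F}
    (f : T -> 'M[C]_N) M (e : R) :
  f @ F --> M -> (\forall t \near F, mxnorm1 (f t) <= e) -> mxnorm1 M <= e.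
Proof.
rewrite mx_cvgP => /cvgr0Pnorm_le fM fe; apply/ler_addgt0Pr => d d0.
have {}fM := fM _ d0.
near F => t.
rewrite (_ : M = f t - (f t - M)); last by rewrite opprB addrC subrK.
apply: (le_trans (mxnorm1B _ _)); apply: lerD; first by near: t.
by apply: (le_trans (ler_norm _)); near: t.
Unshelve. all: by end_near. Qed.

Lemma mx_series_cvg (u : nat -> 'M[C]_N) (a : nat -> R) :
  (forall k, mxnorm1 (u k) <= a k) -> cvgn (series a) -> cvgn (series u).
Proof.
move=> ua ca.
apply/cvg_ex; exists (\matrix_(i, j) Complex
  (limn (series (fun k => complex.Re (u k i j))))
  (limn (series (fun k => complex.Im (u k i j))))).
apply/mx_cvg_coord => b i j.
have -> : (fun n => mxcoord b i j (series u n)) = series (fun k => mxcoord b i j (u k)).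
  by apply/funext => n; rewrite /series/= mxcoord_sum.
suff : cvgn (series (fun k => mxcoord b i j (u k))).
  by case: b; rewrite /mxcoord mxE.
apply: normed_cvg; apply: series_le_cvg ca => n.
- exact: normr_ge0.
- by apply: le_trans (ua n); exact: mxnorm1_ge0.
- by apply: le_trans (ua n); exact: normr_mxcoord.
Qed.

Lemma mx_series_coord (u : nat -> 'M[C]_N) b i j : cvgn (series u) ->
  series (fun k => mxcoord b i j (u k)) @ \oo --> mxcoord b i j (limn (series u)).
Proof.
move=> /mx_cvg_coord/(_ b i j).
by under eq_fun do rewrite /series/= mxcoord_sum.
Qed.

Lemma mx_series_norm_le (u : nat -> 'M[C]_N) (a : nat -> R) :
  (forall k, mxnorm1 (u k) <= a k) -> cvgn (series a) ->
  mxnorm1 (limn (series u)) <= limn (series a).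
Proof.
move=> ua ca; apply: (@mx_cvg_norm_le nat \oo _ (series u)); first exact: (mx_series_cvg ua ca).
apply: nearW => n; apply: (le_trans (mxnorm1_sum _ _ _)).
apply: (@le_trans _ _ (series a n)); first by apply: ler_sum => k _; exact: ua.
apply: nondecreasing_cvgn_le => //; apply: nondecreasing_series => k _ _.
by apply: le_trans (ua k); exact: mxnorm1_ge0.
Qed.

(** The variable is real and the entries are complex, so differentiability is expressed through the
    real coordinates, to each of which real calculus applies. *)
Definition mx_is_derive (F : R -> 'M[C]_N) (t : R) (D : 'M[C]_N) :=
  forall b i j, is_derive t (1 : R) (fun t => mxcoord b i j (F t)) (mxcoord b i j D).

Lemma mx_is_derive_eq F (t : R) D D' : mx_is_derive F t D -> D = D' -> mx_is_derive F t D'.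
Proof. by move=> ? <-. Qed.

Lemma mx_is_deriveZ (f : R -> R) F (t df : R) DF :
  is_derive t 1 f df -> mx_is_derive F t DF ->
  mx_is_derive (fun t => RtoC (f t) *: F t) t (RtoC df *: F t + RtoC (f t) *: DF).
Proof.
move=> hf hF b i j; under eq_fun do rewrite mxcoordZ.
have {}hF := hF b i j.
apply: is_derive_eq (is_deriveM hf hF) _.
by rewrite mxcoordD !mxcoordZ /GRing.scale/= addrC [_ * df]mulrC.
Qed.

Lemma mx_is_derive_comp F (f : R -> R) (t df : R) DF :
  is_derive t 1 f df -> mx_is_derive F (f t) DF ->
  mx_is_derive (F \o f) t (RtoC df *: DF).
Proof.
move=> hf hF b i j; have {}hF := hF b i j.
apply: is_derive_eq (is_derive1_comp hF hf) _.
by rewrite mxcoordZ mulrC.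
Qed.

Lemma mx_is_deriveM F G (t : R) DF DG : mx_is_derive F t DF -> mx_is_derive G t DG ->
  mx_is_derive (fun t => F t *m G t) t (DF *m G t + F t *m DG).
Proof.
move=> hF hG b i j; under eq_fun do rewrite mxcoordM.
rewrite -fct_sumE; apply: is_derive_eq.
  apply: is_derive_sum => k.
  apply: is_deriveD; first by apply: is_deriveM; [exact: hF|exact: hG].
  apply: is_deriveM; last exact: hG.
  by apply: is_deriveM; last exact: hF.
rewrite mxcoordD !mxcoordM -big_split/=; apply: eq_bigr => k _.
rewrite /GRing.scale/= mulr0 addr0; ring.
Qed.

Lemma mx_is_derive0_cst F : (forall t, mx_is_derive F t 0) -> forall s t, F s = F t.
Proof.
move=> hF s t; apply: mxcoord_ext => b i j.
apply: (is_derive_0_is_cst (f := fun t => mxcoord b i j (F t))) => x.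
by have := hF x b i j; rewrite mxcoord0.
Qed.

Lemma mx_is_derive_cvg F (t : R) D : mx_is_derive F t D -> F @ t --> F t.
Proof.
move=> hF; apply/mx_cvg_coord => b i j.
have h := hF b i j; apply: differentiable_continuous.
by apply/derivable1_diffP.
Qed.

End MatrixCoord.

(** * Matrix exponential *)

Section MatrixExponential.
Variables (R : realType) (N : nat).
Local Notation C := (Cplx R).
Implicit Types (M W : 'M[C]_N).

Lemma RtoCM (s t : R) : RtoC (s * t) = RtoC s * RtoC t.
Proof. exact: (rmorphM (real_complex R)). Qed.

Lemma RtoCD (s t : R) : RtoC (s + t) = RtoC s + RtoC t.
Proof. exact: (rmorphD (real_complex R)). Qed.

Lemma RtoCN (s : R) : RtoC (- s) = - RtoC s.
Proof. exact: (rmorphN (real_complex R)). Qed.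

Lemma RtoCX (s : R) n : RtoC (s ^+ n) = RtoC s ^+ n.
Proof. exact: (rmorphXn (real_complex R)). Qed.

Lemma RtoC_nat n : RtoC (n%:R : R) = n%:R.
Proof. exact: (rmorph_nat (real_complex R)). Qed.

Lemma RtoCV (s : R) : RtoC s^-1 = (RtoC s)^-1.
Proof. exact: (fmorphV (real_complex R)). Qed.

Lemma RtoC1 : RtoC (1 : R) = 1.
Proof. by []. Qed.

Lemma mxnorm1X M k : mxnorm1 (M ^+ k) <= mxnorm1 (1%:M : 'M[C]_N) * mxnorm1 M ^+ k.
Proof.
elim: k => [|k IH]; first by rewrite !expr0 mulr1.
rewrite !exprSr mulrA; apply: (le_trans (mxnorm1M _ _)).
by rewrite ler_wpM2r// mxnorm1_ge0.
Qed.

Lemma scalemxX (a : C) M k : (a *: M) ^+ k = a ^+ k *: M ^+ k.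
Proof.
elim: k => [|k IH]; first by rewrite !expr0 scale1r.
rewrite !exprS IH; change ((a *: M) *m (a ^+ k *: M ^+ k) = (a * a ^+ k) *: (M *m M ^+ k)).
by rewrite -scalemxAl -scalemxAr scalerA.
Qed.

Lemma expmx_term (t : R) M k :
  (k`!%:R)^-1 *: (RtoC t *: M) ^+ k = RtoC (t ^+ k / k`!%:R) *: M ^+ k.
Proof. by rewrite scalemxX scalerA RtoCM RtoCV RtoC_nat RtoCX mulrC. Qed.

Lemma expmx_term_le (t K rho : R) M k : 
  mxnorm1 (M ^+ k) <= K * rho ^+ k ->
  mxnorm1 ((k`!%:R)^-1 *: (RtoC t *: M) ^+ k) <= K * exp_coeff (rho * `|t|) k.
Proof.
move=> Mk; rewrite expmx_term mxnorm1ZR normrM normfV normr_nat normrX.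
rewrite /exp_coeff/= exprMn.
rewrite [leRHS](_ : _ = `|t| ^+ k / k`!%:R * (K * rho ^+ k)); last by ring.
by rewrite ler_wpM2l// mulr_ge0.
Qed.

Lemma is_cvg_expmx (t : R) M :
  cvgn (series (fun k => (k`!%:R)^-1 *: (RtoC t *: M) ^+ k)).
Proof.
apply: (mx_series_cvg (fun k => expmx_term_le t (mxnorm1X M k))).
exact: is_cvg_seriesZ (is_cvg_series_exp_coeff _).
Qed.

(** Any geometric bound on the powers is allowed, not only the one given by the norm of [M]: for the
    decay estimate, [rho] comes from the spectrum. *)
Lemma mxnorm1_expmx_le (t K rho : R) M : (forall k, mxnorm1 (M ^+ k) <= K * rho ^+ k) ->
  mxnorm1 (expmx (RtoC t *: M)) <= K * expR (rho * `|t|).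
Proof.
move=> Mk; rewrite /expR -[leRHS](lim_seriesZ K (is_cvg_series_exp_coeff _)).
apply: mx_series_norm_le; first by move=> k; exact: expmx_term_le.
exact: is_cvg_seriesZ (is_cvg_series_exp_coeff _).
Qed.

Lemma is_cvg_pseries_expbound (c : nat -> R) (K rho x : R) :
  (forall k, `|c k| <= K * (rho ^+ k / k`!%:R)) -> cvgn (pseries c x).
Proof.
move=> cK; apply: normed_cvg; apply: (@series_le_cvg _ _ (fun k => K * exp_coeff (rho * `|x|) k)).
- by move=> k; exact: normr_ge0.
- move=> k; rewrite /exp_coeff/= exprMn mulrAC mulrA mulr_ge0 ?exprn_ge0//.
  exact: le_trans (cK k).
- move=> k; rewrite /exp_coeff/= exprMn normrM normrX mulrAC mulrA.
  by rewrite ler_wpM2r ?exprn_ge0.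
- exact: is_cvg_seriesZ (is_cvg_series_exp_coeff _).
Qed.

(** Bounds of the form K rho^k / k! are stable under formal differentiation, with K replaced by K
    rho. Iterated, this supplies the convergence conditions on the first and second derived series
    that termwise differentiation requires. *)
Lemma expbound_pseries_diffs (c : nat -> R) (K rho : R) :
  (forall k, `|c k| <= K * (rho ^+ k / k`!%:R)) ->
  forall k, `|pseries_diffs c k| <= (K * rho) * (rho ^+ k / k`!%:R).
Proof.
move=> cK k; rewrite /pseries_diffs normrM normr_nat.
apply: (le_trans (ler_wpM2l _ (cK k.+1))) => //.
rewrite exprS factS natrM invfM.
rewrite [leLHS](_ : _ = (k.+1%:R / k.+1%:R) * (K * rho * (rho ^+ k / k`!%:R))); last by ring.
by rewrite mulfV ?mul1r// pnatr_eq0.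
Qed.

(** Each real coordinate of e^(tM) is an everywhere convergent real power series in t, and is
    differentiated term by term. *)
Lemma mx_is_derive_expmx M (t : R) :
  mx_is_derive (fun t => expmx (RtoC t *: M)) t (M *m expmx (RtoC t *: M)).
Proof.
move=> b i j.
pose c k := mxcoord b i j (M ^+ k) / k`!%:R.
have cE x : mxcoord b i j (expmx (RtoC x *: M)) = limn (pseries c x).
  apply/esym/cvg_lim => //; have := @mx_series_coord _ _ _ b i j (@is_cvg_expmx x M).
  by under eq_fun do rewrite expmx_term mxcoordZ mulrAC -mulrA mulrC.
have dE : mxcoord b i j (M *m expmx (RtoC t *: M)) = limn (pseries (pseries_diffs c) t).
  have : M *m series (fun k => (k`!%:R)^-1 *: (RtoC t *: M) ^+ k) n @[n --> \oo]
      --> M *m expmx (RtoC t *: M).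
    by apply: mx_cvg_mull; exact: is_cvg_expmx.
  move=> /mx_cvg_coord/(_ b i j).
  move=> h; apply/esym/cvg_lim => //; apply: cvg_trans h.
  apply: near_eq_cvg; apply: nearW => n /=.
  rewrite /series/= mulmx_sumr mxcoord_sum; apply: eq_bigr => k _.
  rewrite expmx_term -scalemxAr mxcoordZ /pseries_diffs /c/= exprS factS natrM invfM.
  rewrite [M * _]/(M *m _); have k0 : k.+1%:R != 0 :> R by rewrite pnatr_eq0.
  by rewrite mulrCA [k.+1%:R * (_ * _)]mulrA mulfV//; ring.
have cK k : `|c k| <= mxnorm1 (1%:M : 'M[C]_N) * (mxnorm1 M ^+ k / k`!%:R).
  rewrite /c normrM normfV normr_nat mulrA ler_wpM2r//.
  exact: le_trans (normr_mxcoord _ _ _ _) (mxnorm1X _ _).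
rewrite dE; under eq_fun do rewrite cE.
apply: (@pseries_snd_diffs _ _ (`|t| + 1)).
- exact: is_cvg_pseries_expbound cK.
- exact: is_cvg_pseries_expbound (expbound_pseries_diffs cK).
- exact: is_cvg_pseries_expbound (expbound_pseries_diffs (expbound_pseries_diffs cK)).
- by rewrite [ltRHS]ger0_norm ?addr_ge0// ltrDl.
Qed.

Lemma expmx0 : expmx (0 : 'M[C]_N) = 1%:M.
Proof.
apply: mx_cvg_lim; apply/mx_cvgP.
apply: (@cvg_trans _ ((fun=> 0 : R) @ \oo)); last exact: cvg_cst.
apply: near_eq_cvg; near=> n.
have n0 : (0 < n)%N by near: n; exists 1.
rewrite /series/= big_ltn// big_nat big1 ?addr0.
  by rewrite expr0 fact0 invr1 scale1r subrr mxnorm1_0.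
move=> [//|k] _; have -> : (0 : 'M[C]_N) ^+ k.+1 = 0 by rewrite exprS; exact: mul0mx.
exact: scaler0.
Unshelve. all: by end_near. Qed.

Lemma comm_mxX M W k : comm_mx W M -> comm_mx W (M ^+ k).
Proof. by move=> WM; apply: (@commrX _ W M k). Qed.

Lemma comm_mx_expmx M W (t : R) : comm_mx W M -> comm_mx W (expmx (RtoC t *: M)).
Proof.
move=> WM; have h := @is_cvg_expmx t M.
apply: (mx_cvg_unique (mx_cvg_mull (W := W) h)).
apply: cvg_trans (mx_cvg_mulr (W := W) h); apply: near_eq_cvg; apply: nearW => n /=.
rewrite /series/= mulmx_sumr mulmx_suml; apply: eq_bigr => k _.
by rewrite expmx_term -scalemxAl -scalemxAr (comm_mxX _ WM).
Qed.

(** The left side has derivative zero because [M] commutes with its exponentials. The inverse, the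
    addition law and the shift by a scalar matrix all follow from the resulting uniqueness for Y' =
    M Y, so that no product of series is rearranged. *)
Lemma expmx_ode M (Y : R -> 'M[C]_N) :
  (forall t, mx_is_derive Y t (M *m Y t)) -> forall t, 
  expmx (RtoC (- t) *: M) *m Y t = Y 0.
Proof.
move=> hY t; pose Z t := expmx (RtoC (- t) *: M) *m Y t.
have hZ : forall t, mx_is_derive Z t 0.
  move=> {}t; apply: mx_is_derive_eq.
    apply: mx_is_deriveM; last exact: hY.
    apply: (@mx_is_derive_comp _ _ (fun t => expmx (RtoC t *: M)) -%R); last first.
      exact: mx_is_derive_expmx.
  have /comm_mx_expmx MM : comm_mx M M by [].
  have -> : RtoC (-1 : R) = -1 by rewrite RtoCN.
  by rewrite scaleN1r mulNmx MM mulmxA addNr.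
by rewrite -[LHS]/(Z t) (mx_is_derive0_cst hZ t 0) /Z oppr0 scale0r expmx0 mul1mx.
Qed.

Lemma expmxNK M (t : R) : expmx (RtoC (- t) *: M) *m expmx (RtoC t *: M) = 1%:M.
Proof.
by rewrite (expmx_ode (mx_is_derive_expmx M)) scale0r expmx0.
Qed.

Lemma expmx_ode_uniq M (Y : R -> 'M[C]_N) :
  (forall t, mx_is_derive Y t (M *m Y t)) ->
  forall t, Y t = expmx (RtoC t *: M) *m Y 0.
Proof.
move=> hY t; rewrite -(expmx_ode hY t) mulmxA.
by have := expmxNK M (- t); rewrite opprK => ->; rewrite mul1mx.
Qed.

Lemma expmx_add M (s t : R) :
  expmx (RtoC (s + t) *: M) = expmx (RtoC s *: M) *m expmx (RtoC t *: M).
Proof.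
rewrite addrC; pose Y s := expmx (RtoC (t + s) *: M).
rewrite -[LHS]/(Y s) (expmx_ode_uniq (M := M) (Y := Y)) /Y ?addr0// => {}s.
apply: mx_is_derive_eq.
  apply: (@mx_is_derive_comp _ _ (fun t => expmx (RtoC t *: M)) (fun s => t + s)).
  exact: mx_is_derive_expmx.
by rewrite -[RHS]scale1r; congr (RtoC _ *: _); rewrite add0r ?mulr1 ?mul1r.
Qed.

Lemma expmx_shift M (a t : R) :
  expmx (RtoC t *: (M + (RtoC a)%:M)) = RtoC (expR (a * t)) *: expmx (RtoC t *: M).
Proof.
pose Y t := RtoC (expR (a * t)) *: expmx (RtoC t *: M).
rewrite -[RHS]/(Y t) (expmx_ode_uniq (M := M + (RtoC a)%:M) (Y := Y)) /Y.
  by rewrite mulr0 expR0 scale0r expmx0 scale1r mulmx1.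
move=> {}t; apply: mx_is_derive_eq.
  apply: mx_is_deriveZ; last exact: mx_is_derive_expmx.
rewrite mulmxDl mul_scalar_mx -scalemxAr scalerA addrC; congr (_ + _ *: _).
by rewrite -RtoCM /GRing.scale/= mulr1 mulrC.
Qed.

End MatrixExponential.

(** * Growth of the exponential under a spectral condition *)

Section Spectral.
Variables (R : realType).
Local Notation C := (Cplx R).

Lemma RtoC_Re_ge0 (a : C) : 0 <= a -> a = RtoC (complex.Re a).
Proof. by rewrite lecE /= => /andP[/eqP h _]; apply: Cplx_ext. Qed.

(** For c > 0, |c - a| < c means |a|^2 < 2 c Re a: the discs centred at c and passing through 0
    exhaust the right half-plane as c grows. *)
Lemma norm_shift_lt (s : seq C) : (forall a, a \in s -> 0 < complex.Re a) ->
  exists2 c0 : R, 0 < c0 & forall a, a \in s -> forall c, c0 <= c -> `|RtoC c - a| < RtoC c.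
Proof.
elim: s => [_|a s IH hs]; first by exists 1.
have [|c1 c10 h1] := IH; first by move=> b bs; apply: hs; rewrite inE bs orbT.
have a0 : 0 < complex.Re a by apply: hs; rewrite inE eqxx.
(* This is |a|^2 / Re a, twice the threshold for [a], so that c >= q already gives the strict
   inequality. *)
pose q := (complex.Re a ^+ 2 + complex.Im a ^+ 2) / complex.Re a.
have q0 : 0 < q by rewrite divr_gt0// ltr_wpDr ?sqr_ge0// exprn_gt0.
exists (c1 + q); first by rewrite addr_gt0.
move=> b; rewrite inE => /predU1P[->|bs] c cc; last first.
  by apply: h1 => //; rewrite (le_trans _ cc)// lerDl ltW.
have qc : q <= c by rewrite (le_trans _ cc)// lerDr ltW.
have c0 : 0 < c by exact: lt_le_trans q0 qc.
have -> : `|RtoC c - a| = RtoC (Num.sqrt ((c - complex.Re a) ^+ 2 + complex.Im a ^+ 2)).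
  by rewrite [`|_|]normc_def Cplx_ReD Cplx_ImD Cplx_ReN Cplx_ImN /= add0r sqrrN.
rewrite ltcR -[ltRHS](gtr0_norm c0) -sqrtr_sqr ltr_sqrt ?exprn_gt0//.
move: qc; rewrite /q ler_pdivrMr// => qc.
have : 0 < c * complex.Re a by exact: mulr_gt0.
move: qc; set u := complex.Re a; set v := complex.Im a; rewrite sqrrB; lra.
Qed.

(** Finitely many strict inequalities leave a uniform gap; the gap c - rho becomes the decay rate of
    the exponential. *)
Lemma norm_lt_gap (s : seq C) (c : R) : 0 < c -> (forall a, a \in s -> `|a| < RtoC c) ->
  exists rho : R, [/\ 0 < rho, rho < c & forall a, a \in s -> `|a| < RtoC rho].
Proof.
move=> c0; elim: s => [_|a s IH hs].
  by exists (c / 2); split=> //; lra.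
have [|r [r0 rc hr]] := IH; first by move=> b bs; apply: hs; rewrite inE bs orbT.
have : `|a| < RtoC c by apply: hs; rewrite inE eqxx.
have aE : `|a| = RtoC (complex.Re `|a|) by exact: RtoC_Re_ge0.
rewrite aE ltcR => ac.
pose p := Num.max r ((complex.Re `|a| + c) / 2).
have ra : complex.Re `|a| < p by rewrite lt_max; apply/orP; right; lra.
exists p; split.
- by rewrite lt_max r0.
- by rewrite gt_max rc andTb; lra.
- move=> b; rewrite inE => /predU1P[->|bs]; first by rewrite aE ltcR.
  by apply: lt_le_trans (hr _ bs) _; rewrite lecR le_max lexx.
Qed.

(* With B = c - A, peeling one factor A - a off the annihilating product turns
   the powers W B^k into a scalar recursion of ratio c - a, of modulus < rho,
   forced by the powers of the shorter product. *)
Lemma powmx_entry_growth (N : nat) (A : 'M[C]_N) (c : C) (rho : R) (s : seq C) (W : 'M[C]_N) :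
  (forall a, a \in s -> `|c - a| < RtoC rho) ->
  W *m (\prod_(a <- s) (A - a%:M)) = 0 ->
  exists2 K : C, 0 <= K &
    forall k i j, `|(W *m (c%:M - A) ^+ k) i j| <= K * RtoC rho ^+ k.
Proof.
elim: s W => [|a s IH] W hs.
  rewrite big_nil [1]/(1%:M) mulmx1 => ->; exists 0 => // k i j.
  by rewrite mul0mx mxE normr0 mul0r.
rewrite big_cons [_ * _]/(_ *m _) mulmxA => W0.
have [|K' K'0 hK'] := IH (W *m (A - a%:M)) _ W0.
  by move=> b bs; apply: hs; rewrite inE bs orbT.
have ac : `|c - a| < RtoC rho by apply: hs; rewrite inE eqxx.
have rho0 : 0 <= RtoC rho by apply: le_trans (ltW ac).
pose d := RtoC rho - `|c - a|.
have d0 : 0 < d by rewrite subr_gt0.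
pose S := \sum_i \sum_j `|W i j|.
have S0 : 0 <= S by do 2!apply: sumr_ge0 => ? _.
have WS i j : `|W i j| <= S.
  rewrite /S (bigD1 i)//= (bigD1 j)//= -addrA lerDl addr_ge0//.
    by apply: sumr_ge0.
  by do 2!apply: sumr_ge0 => ? _.
(* A constant K closes the induction as soon as |c - a| K + K' <= rho K, that is, K' <= K d; the
   summand [S] covers k = 0. *)
exists (S + K' / d); first by rewrite addr_ge0// divr_ge0// ltW.
have Kd : K' <= (S + K' / d) * d by rewrite mulrDl divfK ?gt_eqF// lerDr mulr_ge0// ltW.
elim=> [|k IHk] i j.
  rewrite !expr0 [1]/(1%:M) mulmx1 mulr1.
  by rewrite (le_trans (WS i j))// lerDl divr_ge0// ltW.
have -> : W *m (c%:M - A) ^+ k.+1 =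
   (c - a) *: (W *m (c%:M - A) ^+ k) - (W *m (A - a%:M)) *m (c%:M - A) ^+ k.
  rewrite exprS [_ * _]/(_ *m _) mulmxA !mulmxBr !mulmxBl !mul_mx_scalar -!scalemxAl.
  by rewrite scalerBl opprB addrA subrK.
have E (Y Z : 'M[C]_N) (p : C) : (p *: Y - Z) i j = p * Y i j - Z i j by rewrite !mxE.
rewrite E (le_trans (ler_normB _ _))// normrM.
apply: (@le_trans _ _ (`|c - a| * ((S + K' / d) * RtoC rho ^+ k) + K' * RtoC rho ^+ k)).
  by apply: lerD => //; rewrite ler_wpM2l.
rewrite exprS [leRHS]mulrA [X in X + _ <= _]mulrA -mulrDl ler_wpM2r ?exprn_ge0//.
by rewrite -lerBrDl (le_trans Kd)// /d mulrBr [`|_| * _]mulrC.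
Qed.

(* For c large, c - a lies in a disc of radius rho < c for every eigenvalue a, so
   the powers of B = c - A are O(rho^k) and e^(tA) = e^(ct) e^(-tB). *)
Lemma expmx_decay (N : nat) (A : 'M[C]_N) : Re_pos A ->
  exists K eps : R, [/\ 0 <= K, 0 < eps &
   forall t : R, t <= 0 -> mxnorm1 (expmx (RtoC t *: A)) <= K * expR (eps * t)].
Proof.
case: N A => [|n] A hA.
  exists 0, 1; split=> // t _; rewrite mul0r.
  by rewrite /mxnorm1 big_ord0.
have [s] := closed_field_poly_normal (char_poly A).
rewrite (monicP (char_poly_monic A)) scale1r => sE.
have hs a : a \in s -> 0 < complex.Re a.
  move=> as_; apply: hA; rewrite eigenvalue_root_char sE.
  by rewrite root_prod_XsubC.
have [c c0 hc] := norm_shift_lt hs.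
have [rho [rho0 rhoc hrho]] : exists rho : R, [/\ 0 < rho, rho < c &
   forall a, a \in [seq RtoC c - a | a <- s] -> `|a| < RtoC rho].
  apply: norm_lt_gap => // a /mapP[b bs ->]; exact: hc.
have P0 : 1%:M *m (\prod_(a <- s) (A - a%:M)) = 0.
  rewrite mul1mx -(Cayley_Hamilton A) sE rmorph_prod; apply: eq_bigr => a _.
  by rewrite rmorphB/= horner_mx_X horner_mx_C.
have [|K K0 hK] := @powmx_entry_growth _ A (RtoC c) rho s _ _ P0.
  by move=> a as_; apply: hrho; apply: map_f.
pose K1 := (n.+1 * n.+1)%:R * (2 * complex.Re K).
have ReK0 : 0 <= complex.Re K by move: K0; rewrite lecE/= => /andP[].
have hB k : mxnorm1 (((RtoC c)%:M - A) ^+ k) <= K1 * rho ^+ k.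
  rewrite /K1 -mulrA -sum_ord2_const; apply: ler_sum => i _; apply: ler_sum => j _.
  rewrite -mulrA; apply: cnorm1_le.
  have := hK k i j; rewrite mul1mx (RtoC_Re_ge0 K0) => h; apply: (le_trans h).
  by rewrite RtoCM RtoCX.
exists K1, (c - rho); split.
- by rewrite !mulr_ge0.
- by rewrite subr_gt0.
- move=> t t0.
  have -> : RtoC t *: A = RtoC (- t) *: (((RtoC c)%:M - A) + (RtoC (- c))%:M).
    have -> : (RtoC c)%:M - A + (RtoC (- c))%:M = - A.
      by rewrite RtoCN raddfN/= addrAC subrr add0r.
    by rewrite RtoCN scaleNr scalerN opprK.
  rewrite expmx_shift mxnorm1ZR ger0_norm ?expR_ge0//.
  apply: (le_trans (ler_wpM2l (expR_ge0 _) (mxnorm1_expmx_le (- t) hB))).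
  rewrite mulrCA -expRD ler_wpM2l ?mulr_ge0// ler_expR.
  rewrite normrN ler0_norm//; lra.
Qed.

(** The spectral decay serves t <= 0 and the crude norm bound serves t > 0. Their sum gives |t^A| <=
    K (t^p + t^q) for all t > 0 without a case distinction at t = 1, and hence majorants made of
    scalar Gamma kernels. *)
Lemma expmx_growth (N : nat) (A : 'M[C]_N) : Re_pos A ->
  exists K p q : R, [/\ 0 <= K, 0 < p, 0 < q &
   forall t : R, mxnorm1 (expmx (RtoC t *: A)) <= K * (expR (p * t) + expR (q * t))].
Proof.
move=> /expmx_decay[K [p [K0 p0 hK]]].
exists (Num.max K (mxnorm1 (1%:M : 'M[C]_N))), p, (mxnorm1 A + 1); split=> //.
- by rewrite le_max K0.
- by rewrite ltr_wpDl ?mxnorm1_ge0.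
move=> t; have [t0|t0] := leP t 0.
  apply: (le_trans (hK _ t0)).
  apply: ler_pM; [by []|exact: expR_ge0|by rewrite le_max lexx|].
  by rewrite lerDl expR_ge0.
apply: (le_trans (mxnorm1_expmx_le _ (mxnorm1X A))).
apply: ler_pM; [exact: mxnorm1_ge0|exact: expR_ge0|by rewrite le_max lexx orbT|].
rewrite (gtr0_norm t0); apply: (@le_trans _ _ (expR ((mxnorm1 A + 1) * t))).
  by rewrite ler_expR mulrDl lerDl mul1r ltW.
by rewrite lerDr expR_ge0.
Qed.

End Spectral.

(** * Integrals over the positive half-line *)

Section RealIntegrals.
Variables (R : realType).
Local Notation mu := (@lebesgue_measure R).
Local Notation pos := (`]0, +oo[%classic : set R).
Implicit Types (f g F : R -> R) (D : set R).

Lemma pos_continuous_measurable D f : measurable D -> D `<=` pos ->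
  (forall t : R, 0 < t -> {for t, continuous f}) -> measurable_fun D f.
Proof.
move=> mD Dpos cf; apply: (@measurable_funS _ _ _ _ pos) => //.
apply: open_continuous_measurable_fun; first exact: interval_open.
by move=> t; rewrite inE/= in_itv/= andbT; exact: cf.
Qed.

Lemma le_Rintegrable D f g : measurable D -> measurable_fun D f ->
  (forall t, D t -> `|f t| <= g t) ->
  mu.-integrable D (EFin \o g) -> mu.-integrable D (EFin \o f).
Proof.
move=> mD mf fg; apply: le_integrable => //; first exact/measurable_EFinP.
move=> t Dt /=; rewrite lee_fin (le_trans (fg t Dt))//.
exact: ler_norm.
Qed.

Lemma Rintegral_dominated_cvg D (f_ : nat -> R -> R) f g : measurable D ->
  (forall n, measurable_fun D (f_ n)) -> measurable_fun D f ->
  (forall t, D t -> f_ n t @[n --> \oo] --> f t) ->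
  mu.-integrable D (EFin \o g) -> (forall n t, D t -> `|f_ n t| <= g t) ->
  mu.-integrable D (EFin \o f) /\
  (\int[mu]_(t in D) f_ n t) @[n --> \oo] --> \int[mu]_(t in D) f t.
Proof.
move=> mD mf_ mf f_f ig f_g.
have [] := @dominated_convergence _ _ R mu D mD (fun n => EFin \o f_ n) (EFin \o f) (EFin \o g).
- by move=> n; apply/measurable_EFinP; exact: mf_.
- exact/measurable_EFinP.
- apply: aeW => t Dt; apply: cvg_EFin; first exact: nearW.
  exact: f_f.
- exact: ig.
- by apply: aeW => t n Dt /=; rewrite lee_fin f_g.
move=> intf _ h; split => //.
rewrite -[\int[mu]_(t in D) f t]/(fine _); apply: fine_cvg.
by rewrite fineK//; exact: integrable_fin_num.
Qed.

Lemma Rintegral_exhaust_cvg D (E : nat -> set R) f : measurable D ->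
  (forall n, measurable (E n)) -> (forall n, E n `<=` D) ->
  (forall t, D t -> \forall n \near \oo, E n t) ->
  mu.-integrable D (EFin \o f) ->
  (\int[mu]_(t in E n) f t) @[n --> \oo] --> \int[mu]_(t in D) f t.
Proof.
move=> mD mE ED Et intf.
have mf : measurable_fun D f by move/integrableP : intf => -[/measurable_EFinP].
have -> : (fun n => \int[mu]_(t in E n) f t) = (fun n => \int[mu]_(t in D) (f \_ (E n)) t).
  by apply/funext => n; rewrite -Rintegral_mkcondr setIidr.
apply: (proj2 (@Rintegral_dominated_cvg D _ f (fun t => `|f t|) _ _ _ _ _ _)) => //.
- move=> n; apply/measurable_restrict => //.
  by apply: measurable_funS mf => // t [].
- move=> t Dt; apply: cvg_near_cst; apply: filterS (Et t Dt) => n Ent.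
  by rewrite patchE mem_set.
- exact: (integrable_abse intf).
- move=> n t Dt; rewrite patchE; case: ifP => // _.
  by rewrite normr0.
Qed.

Lemma Rintegral_pinfty_cvg f : mu.-integrable pos (EFin \o f) ->
  (\int[mu]_(t in `]0, T]) f t) @[T --> +oo] --> \int[mu]_(t in pos) f t.
Proof.
move=> intf; apply/cvg_pinftyP => u uoo.
apply: Rintegral_exhaust_cvg => //.
- by move=> n t /=; rewrite !in_itv/= andbT => /andP[].
- move=> t /=; rewrite in_itv/= andbT => t0.
  move/cvgryPge : uoo => /(_ t); apply: filterS => n tu.
  by rewrite in_itv/= t0.
Qed.

Lemma pos_cc_exhaust (t : R) : pos t -> \forall n \near \oo, `[n.+1%:R^-1, n.+1%:R : R]%classic t.
Proof.
rewrite /= in_itv/= andbT => t0; near=> n.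
rewrite in_itv/=; apply/andP; split.
- rewrite invf_ple ?posrE//; apply: (@le_trans _ _ n%:R); last by rewrite ler_nat.
  by near: n; exact: nbhs_infty_ger.
- apply: (@le_trans _ _ n%:R); last by rewrite ler_nat.
  by near: n; exact: nbhs_infty_ger.
Unshelve. all: by end_near. Qed.

Lemma is_derive_continuous F (t a : R) : is_derive t 1 F a -> {for t, continuous F}.
Proof. by move=> h; apply/differentiable_continuous/derivable1_diffP. Qed.

Lemma pos_FTC F f (a b : R) : 0 < a -> a < b ->
  (forall t : R, 0 < t -> is_derive t 1 F (f t)) ->
  (forall t : R, 0 < t -> {for t, continuous f}) ->
  (\int[mu]_(t in `[a, b]) (f t)%:E = (F b)%:E - (F a)%:E)%E.
Proof.
move=> a0 ab dF cf; apply: continuous_FTC2 => //.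
- apply: continuous_in_subspaceT => t; rewrite inE/= in_itv/= => /andP[ta _].
  by apply: cf; exact: lt_le_trans ta.
- split.
  + move=> t; rewrite in_itv/= => /andP[ta _].
    by apply: ex_derive; apply: dF; exact: lt_trans ta.
  + apply: cvg_at_right_filter; exact: is_derive_continuous (dF a a0).
  + apply: cvg_at_left_filter; exact: is_derive_continuous (dF b (lt_trans a0 ab)).
- move=> t; rewrite in_itv/= => /andP[ta _].
  by rewrite derive1E; have /@derive_val -> := dF t (lt_trans a0 ta).
Qed.

(** The shift by 2 makes [1/(n+2), n+2] nondegenerate already for n = 0, as [pos_FTC] requires. *)
Lemma natS_inv_lt (n : nat) : n.+2%:R^-1 < n.+2%:R :> R.
Proof. by rewrite (@lt_trans _ _ 1)// ?invf_lt1 ?ltr1n. Qed.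

(** On each compact interval the integral is a difference of two values of [F], hence at most 2M;
    monotone convergence extends the bound to the half-line and treats 0 and infinity together. *)
Lemma integrable_of_bounded_primitive F f (M : R) :
  (forall t : R, 0 < t -> is_derive t 1 F (f t)) ->
  (forall t : R, 0 < t -> {for t, continuous f}) ->
  (forall t : R, 0 < t -> 0 <= f t) ->
  (forall t : R, 0 < t -> `|F t| <= M) ->
  mu.-integrable pos (EFin \o f).
Proof.
move=> dF cf f0 FM.
have mf : measurable_fun pos f by exact: pos_continuous_measurable.
apply/integrableP; split; first exact/measurable_EFinP.
pose E n := `[n.+2%:R^-1, n.+2%:R : R]%classic.
have posE : pos = \bigcup_n E n.
  apply/seteqP; split => t.
    move=> /pos_cc_exhaust[n _ /(_ n.+1)] /= h.
    by exists n => //; exact: h.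
  move=> [n _]; rewrite /E /= !in_itv/= andbT => /andP[h _].
  by apply: lt_le_trans h; rewrite invr_gt0.
have Epos n : E n `<=` pos by rewrite posE; exact: bigcup_sup.
have -> : (\int[mu]_(t in pos) `|(EFin \o f) t| = \int[mu]_(t in pos) (f t)%:E)%E.
  apply: eq_integral => t; rewrite inE/= in_itv/= andbT => t0.
  by rewrite ger0_norm// f0.
have h : (\int[mu]_(t in E n) (EFin \o f) t @[n --> \oo] -->
    \int[mu]_(t in \bigcup_n E n) (EFin \o f) t)%E.
  apply: ge0_nondecreasing_set_cvg_integral.
  - move=> m n mn; apply/subsetPset => t; rewrite /E/= !in_itv/= => /andP[h1 h2].
    apply/andP; split.
      by apply: le_trans h1; rewrite lef_pV2 ?posrE// ler_nat !ltnS.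
    by apply: (le_trans h2); rewrite ler_nat !ltnS.
  - by move=> n; exact: measurable_itv.
  - move=> n; apply/measurable_EFinP; exact: measurable_funS mf.
  - by move=> n t /Epos; rewrite /= in_itv/= andbT => t0; rewrite lee_fin f0.
apply: (@le_lt_trans _ _ (M + M)%:E); last exact: ltry.
rewrite posE; apply: (cvge_to_le h); apply: nearW => n /=.
rewrite (pos_FTC (F := F))// ?natS_inv_lt ?invr_gt0//.
rewrite -EFinB lee_fin (le_trans (ler_norm _))// (le_trans (ler_normB _ _))//.
by apply: lerD; apply: FM; rewrite ?invr_gt0.
Qed.

(** Integrability is known beforehand, so dominated convergence over the intervals [1/(n+2), n+2]
    identifies the integral, and boundary limits along these two sequences suffice. *)
Lemma Rintegral_derive_pos F f (l0 : R) (loo : R) :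
  (forall t : R, 0 < t -> is_derive t 1 F (f t)) ->
  (forall t : R, 0 < t -> {for t, continuous f}) ->
  F n.+2%:R^-1 @[n --> \oo] --> l0 -> F n.+2%:R @[n --> \oo] --> loo ->
  mu.-integrable pos (EFin \o f) ->
  \int[mu]_(t in pos) f t = loo - l0.
Proof.
move=> dF cf F0 Foo intf.
pose E n := `[n.+2%:R^-1, n.+2%:R : R]%classic.
have h : (\int[mu]_(t in E n) f t) @[n --> \oo] --> \int[mu]_(t in pos) f t.
  apply: Rintegral_exhaust_cvg => //.
  - by move=> n; exact: measurable_itv.
  - move=> n t; rewrite /E /= !in_itv/= andbT => /andP[h _].
    by apply: lt_le_trans h; rewrite invr_gt0.
  - move=> t /pos_cc_exhaust[m _ h]; exists m => // n /= mn.
    exact: (h n.+1 (leqW mn)).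
have {}h : F n.+2%:R - F n.+2%:R^-1 @[n --> \oo] --> \int[mu]_(t in pos) f t.
  apply: cvg_trans h; apply: near_eq_cvg; apply: nearW => n.
  by rewrite /Rintegral (pos_FTC (F := F))// ?natS_inv_lt ?invr_gt0.
by apply: (cvg_unique _ h); [exact: Rhausdorff|exact: cvgB].
Qed.

End RealIntegrals.

(** * The scalar Gamma kernel and its integrability *)

Section GammaKernel.
Variables (R : realType).
Local Notation mu := (@lebesgue_measure R).
Local Notation pos := (`]0, +oo[%classic : set R).

(* t^(p-1) e^(-d t) for t > 0 *)
Definition gker (p d t : R) : R := expR (p * ln t - d * t) / t.

Lemma gker_ge0 p d t : 0 < t -> 0 <= gker p d t.
Proof. by move=> t0; rewrite divr_ge0 ?expR_ge0// ltW. Qed.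

Lemma is_derive_lnDl (a t : R) : 0 < a + t -> is_derive t 1 (fun t => ln (a + t)) (a + t)^-1.
Proof.
move=> h; have h1 := is_derive1_ln h.
apply: is_derive_eq (is_derive1_comp h1 (is_deriveD (is_derive_cst a t 1) (is_derive_id t 1))) _.
by rewrite add0r mulr1.
Qed.

Lemma continuous_gker (p d t : R) : 0 < t -> {for t, continuous (gker p d)}.
Proof.
move=> t0; apply: cvgM; last by apply: cvgV; [rewrite gt_eqF|exact: cvg_id].
apply: continuous_comp; last exact: continuous_expR.
apply: cvgB; apply: cvgMr; last exact: cvg_id.
exact: continuous_ln.
Qed.

(* The kernel is dominated by a multiple of the derivative of (t / (1 + t))^p. *)
Lemma integrable_gker (p d : R) : 0 < p -> 0 < d ->
  mu.-integrable pos (EFin \o gker p d).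
Proof.
move=> p0 d0.
pose F t : R := expR (p * (ln t - ln (1 + t))).
pose f t : R := F t * (p * (t^-1 - (1 + t)^-1)).
have dF (t : R) : 0 < t -> is_derive t 1 F (f t).
  move=> t0; have h1 := is_derive1_ln t0.
  have h2 := is_derive_lnDl (addr_gt0 ltr01 t0).
  exact: (is_derive1_comp (is_derive_expR _) (is_deriveZ p (is_deriveB h1 h2))).
have cF (t : R) : 0 < t -> {for t, continuous F}.
  by move=> t0; exact: is_derive_continuous (dF t t0).
have cf (t : R) : 0 < t -> {for t, continuous f}.
  move=> t0; apply: cvgM; first exact: cF.
  apply: cvgMr; apply: cvgB; first by apply: cvgV; [rewrite gt_eqF|exact: cvg_id].
  apply: cvgV; first by rewrite gt_eqF// addr_gt0.
  by apply: cvgD; [exact: cvg_cst|exact: cvg_id].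
have f0 (t : R) : 0 < t -> 0 <= f t.
  move=> t0; rewrite mulr_ge0 ?expR_ge0// mulr_ge0 ?ltW// subr_gt0.
  by rewrite ltf_pV2 ?posrE ?addr_gt0// ltrDr.
have F1 (t : R) : 0 < t -> `|F t| <= 1.
  move=> t0; rewrite ger0_norm ?expR_ge0// -expR0 ler_expR pmulr_rle0// subr_le0.
  by rewrite ler_ln ?posrE ?addr_gt0// lerDr.
have intf := integrable_of_bounded_primitive dF cf f0 F1.
(* The kernel divided by [f] is (1 + t)^(p+1) e^(-dt) / p. The bound [K] on it is ln y <= y - 1 at y
   = eta (1 + t), with [eta] chosen so that (p + 1) eta = d. *)
pose eta := d / (p + 1).
have eta0 : 0 < eta by rewrite divr_gt0// addr_gt0.
pose K := expR (d - (p + 1) * (1 + ln eta)) / p.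
apply: (@le_Rintegrable _ _ _ (fun t => K * f t)) => //.
- by apply: pos_continuous_measurable => // t; exact: continuous_gker.
- move=> t /=; rewrite in_itv/= andbT => t0.
  rewrite ger0_norm ?gker_ge0//.
  have s0 : 0 < 1 + t by rewrite addr_gt0.
  have lns : (p + 1) * ln (1 + t) <= d * (1 + t) - (p + 1) * (1 + ln eta).
    have : ln (eta * (1 + t)) <= eta * (1 + t) - 1.
      have := @le_ln1Dx _ (eta * (1 + t) - 1); rewrite addrCA subrr addr0; apply.
      by rewrite ltrBrDl subrr mulr_gt0.
    rewrite lnM// => h.
    have -> : d = eta * (p + 1) by rewrite /eta divfK// gt_eqF// addr_gt0.
    have p1 : 0 <= p + 1 by rewrite addr_ge0// ltW.
    have {h} : (p + 1) * (ln eta + ln (1 + t)) <= (p + 1) * (eta * (1 + t) - 1).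
      by rewrite ler_wpM2l.
    lra.
  have -> : K * f t = expR (d - (p + 1) * (1 + ln eta)) * F t / (t * (1 + t)).
    by rewrite /K /f; field; rewrite !gt_eqF.
  rewrite /gker invfM mulrA mulrAC ler_wpM2r ?invr_ge0 ?(ltW t0)//.
  rewrite ler_pdivlMr// -{1}(lnK s0) /F -!expRD ler_expR.
  lra.
- exact: (@integrableZl _ _ _ _ _ _ K _ intf).
Qed.

Lemma gkerM (p d q e t : R) : expR (q * ln t - e * t) * gker p d t = gker (q + p) (e + d) t.
Proof. by rewrite /gker mulrA -expRD; congr (expR _ / _); ring. Qed.

Lemma expRB_ln n (t : R) : 0 < t -> t ^+ n = expR (n%:R * ln t).
Proof. by move=> t0; rewrite mulr_natl -lnXn// lnK// posrE exprn_gt0. Qed.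

Lemma gkerXM (p d t : R) n : 0 < t -> t ^+ n * gker p d t = gker (n%:R + p) d t.
Proof.
move=> t0; rewrite expRB_ln// -[n%:R * _]subr0 -(mul0r t) gkerM.
by rewrite add0r.
Qed.

End GammaKernel.

(** * Abel's theorem for improper integrals *)

Section Abel.
Variables (R : realType).
Local Notation mu := (@lebesgue_measure R).
Local Notation pos := (`]0, +oo[%classic : set R).
Implicit Types (f g F : R -> R).

Lemma derive_ge0_le (F f : R -> R) (a b : R) : 0 < a -> a <= b ->
  (forall t : R, a <= t -> is_derive t 1 F (f t)) ->
  (forall t : R, a <= t -> 0 <= f t) -> F a <= F b.
Proof.
move=> a0 ab dF f0; apply: (@ger0_derive1_ndecr _ F a b) => //.
- by move=> t; rewrite in_itv/= => /andP[/ltW at_ _]; apply: ex_derive; exact: dF.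
- move=> t; rewrite in_itv/= => /andP[/ltW at_ _].
  by rewrite derive1E; have /@derive_val -> := dF t at_; exact: f0.
- apply: continuous_in_subspaceT => t; rewrite inE/= in_itv/= => /andP[at_ _].
  exact: is_derive_continuous (dF t at_).
Qed.

(** A mean value inequality with variable bound: both F + G and G - F are nondecreasing. *)
Lemma derive_bound_le (F f G g : R -> R) (a b : R) : 0 < a -> a <= b ->
  (forall t : R, a <= t -> is_derive t 1 F (f t)) ->
  (forall t : R, a <= t -> is_derive t 1 G (g t)) ->
  (forall t : R, a <= t -> `|f t| <= g t) -> `|F b - F a| <= G b - G a.
Proof.
move=> a0 ab dF dG fg; rewrite ler_norml; apply/andP; split.
- have : F a + G a <= F b + G b.
    apply: (@derive_ge0_le (F + G) (fun t => f t + g t) a b a0 ab) => t at_.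
      by apply: is_deriveD; [exact: dF|exact: dG].
    by have := fg t at_; rewrite ler_norml => /andP[]; lra.
  by lra.
- have : G a - F a <= G b - F b.
    apply: (@derive_ge0_le (G - F) (fun t => g t - f t) a b a0 ab) => t at_.
      by apply: is_deriveB; [exact: dG|exact: dF].
    by have := fg t at_; rewrite ler_norml => /andP[]; lra.
  by lra.
Qed.

Lemma is_derive_Rintegral f (t : R) : 0 < t ->
  (forall T : R, mu.-integrable `]0, T] (EFin \o f)) -> {for t, continuous f} ->
  is_derive t 1 (fun T => \int[mu]_(u in `]0, T]) f u) (f t).
Proof.
move=> t0 intf cf.
have [d1 d2] := @continuous_FTC1 R f (BRight 0) t (t + 1) (ltr_pwDr ltr01 (lexx t)) (intf _) t0 cf.
by apply: DeriveDef => //; rewrite -derive1E.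
Qed.

Lemma integrable_pos_itv f : mu.-integrable pos (EFin \o f) ->
  forall T : R, mu.-integrable `]0, T] (EFin \o f).
Proof.
move=> intf T; apply: integrableS intf => // t /=.
by rewrite !in_itv/= andbT => /andP[].
Qed.

(* With F T = int_0^T f, the function
   int_0^T e^(-dt) f(t) dt - e^(-dT) (F T - F a) has derivative d e^(-dT) (F T - F a),
   which is small uniformly in d once F is nearly constant on [a, +oo[. *)
Lemma Abel_integral f (I : R) (d : nat -> R) :
  (forall t : R, 0 < t -> {for t, continuous f}) ->
  (forall T : R, mu.-integrable `]0, T] (EFin \o f)) ->
  (\int[mu]_(t in `]0, T]) f t) @[T --> +oo] --> I ->
  (forall n, 0 < d n) -> d n @[n --> \oo] --> 0 ->
  (forall n, mu.-integrable pos (EFin \o (fun t => expR (- d n * t) * f t))) ->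
  (\int[mu]_(t in pos) (expR (- d n * t) * f t)) @[n --> \oo] --> I.
Proof.
move=> cf intf fI d0 dc intdf.
pose F T : R := \int[mu]_(t in `]0, T]) f t.
have dF (t : R) : 0 < t -> is_derive t 1 F (f t).
  by move=> t0; apply: is_derive_Rintegral => //; exact: cf.
apply/cvgrPdist_le => e e0.
(* The error [e] is spent as e/4 on I - F a, e/4 on F a - G n a, and e/2 on the part beyond [a]. *)
have e3 : 0 < e / 4 by rewrite divr_gt0.
have [a a0 aF] : exists2 a : R, 0 < a & forall t, a <= t -> `|I - F t| <= e / 4.
  move/cvgrPdist_le : fI => /(_ _ e3) [a [_ ha]].
  exists (Num.max 1 (a + 1)); first by rewrite lt_max ltr01.
  by move=> t; rewrite ge_max => /andP[_ h]; apply: ha; rewrite (lt_le_trans _ h)// ltrDl.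
have Fa t : a <= t -> `|F t - F a| <= e / 2.
  move=> at_; have := aF t at_; have := aF a (lexx _).
  by rewrite !ler_norml; lra.
pose G n T : R := \int[mu]_(t in `]0, T]) (expR (- d n * t) * f t).
have Ga : G n a @[n --> \oo] --> F a.
  apply: (proj2 (@Rintegral_dominated_cvg R _ (fun n t => expR (- d n * t) * f t) f
    (fun t => `|f t|) _ _ _ _ _ _)) => //.
  - move=> n; have := integrable_pos_itv (intdf n) a.
    by move=> /integrableP[/measurable_EFinP].
  - by move: (intf a) => /integrableP[/measurable_EFinP].
  - move=> t _; rewrite -[X in _ --> X]mul1r; apply: cvgMl.
    rewrite -[X in _ --> X]expR0; apply: continuous_cvg; first exact: continuous_expR.
    rewrite -[X in _ --> X](mul0r t) -oppr0; apply: cvgMl.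
    exact: cvgN.
  - exact: (integrable_abse (intf a)).
  - move=> n t /=; rewrite in_itv/= => /andP[t0 _].
    rewrite normrM ler_piMl// ger0_norm ?expR_ge0// -expR0 ler_expR.
    by rewrite mulNr oppr_le0 mulr_ge0// ltW.
have GT n T : a <= T -> `|G n T - expR (- d n * T) * (F T - F a) - G n a| <= e / 2.
  move=> aT.
  pose H t := G n t - expR (- d n * t) * (F t - F a).
  have dE (t : R) : is_derive t 1 (fun t => expR (- d n * t)) (- d n * expR (- d n * t)).
    have h := is_derive1_comp (is_derive_expR (- d n * t)) (is_deriveZ (- d n) (is_derive_id t 1)).
    apply: is_derive_eq h _.
    by rewrite /GRing.scale/= mulr1 mulrC.
  have dH (t : R) : a <= t -> is_derive t 1 H (d n * expR (- d n * t) * (F t - F a)).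
    move=> at_; have t0 := lt_le_trans a0 at_.
    have dG : is_derive t 1 (G n) (expR (- d n * t) * f t).
      apply: is_derive_Rintegral => //; first exact: integrable_pos_itv (intdf n).
      apply: cvgM; last exact: cf.
      exact: is_derive_continuous (dE t).
    have dFa : is_derive t 1 (fun t => F t - F a) (f t).
      apply: is_derive_eq (is_deriveB (dF t t0) (is_derive_cst (F a) t 1)) _.
      by rewrite subr0.
    apply: is_derive_eq (is_deriveB dG (is_deriveM (dE t) dFa)) _.
    rewrite /GRing.scale/=; ring.
  (* The comparison function -(e/2) e^(-dt) has a derivative dominating that of [H] in absolute
     value, and increases by at most e/2 on [a, T], whatever [n] and [T] are. *)
  have dK (t : R) : a <= t -> is_derive t 1 (fun t => - (e / 2) * expR (- d n * t))
      (e / 2 * (d n * expR (- d n * t))).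
    move=> _; apply: is_derive_eq (is_deriveZ (- (e / 2)) (dE t)) _.
    rewrite /GRing.scale/=; ring.
  have := derive_bound_le a0 aT dH dK.
  have -> : H a = G n a by rewrite /H subrr mulr0 subr0.
  rewrite -/(H T) => h; apply: (le_trans (h _)).
  - have de t : 0 <= d n * expR (- d n * t) by rewrite mulr_ge0 ?expR_ge0// ltW.
    by move=> t at_; rewrite normrM mulrC (ger0_norm (de t)) ler_wpM2r// Fa.
  - have x0 (u : R) : 0 <= u -> 0 < expR (- d n * u) <= 1.
      move=> u0; rewrite expR_gt0 -expR0 ler_expR mulNr oppr_le0 mulr_ge0//.
      exact: ltW.
    have := x0 a (ltW a0); have := x0 T (ltW (lt_le_trans a0 aT)).
    have := e0; set u := expR _; set v := expR _ => e0' /andP[u0 u1] /andP[v0 v1].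
    have : 0 <= e / 2 * (1 - v + u) by rewrite mulr_ge0//; lra.
    lra.
have Goo n : `|\int[mu]_(t in pos) (expR (- d n * t) * f t) - G n a| <= e / 2.
  have h1 : G n T @[T --> +oo] --> \int[mu]_(t in pos) (expR (- d n * t) * f t).
    exact: Rintegral_pinfty_cvg.
  have h2 : expR (- d n * T) * (F T - F a) @[T --> +oo] --> 0.
    rewrite -(mul0r (I - F a)); apply: cvgM; last by apply: cvgB => //; exact: cvg_cst.
    have -> : (fun T => expR (- d n * T)) = (fun u => expR (- u)) \o (fun T => T * d n).
      by apply/funext => T /=; rewrite mulNr mulrC.
    apply: cvg_comp (@cvgr_expR R).
    by apply: gt0_cvgMly; [exact: d0|exact: cvg_id].
  have h3 : `|G n T - expR (- d n * T) * (F T - F a) - G n a| @[T --> +oo]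
     --> `|\int[mu]_(t in pos) (expR (- d n * t) * f t) - 0 - G n a|.
    by apply: cvg_norm; apply: cvgB; [exact: cvgB|exact: cvg_cst].
  rewrite subr0 in h3; apply: (cvgr_to_le h3).
  near=> T; apply: GT; near: T; apply: nbhs_pinfty_ge; exact: num_real.
move/cvgrPdist_le : Ga => /(_ _ e3); apply: filterS => n h1.
have h2 := Goo n; have h3 := aF a (lexx a).
by move: h1 h2 h3; rewrite !ler_norml; lra.
Unshelve. all: by end_near. Qed.

End Abel.

(** * Integrals of matrix-valued functions *)

Section MatrixIntegrals.
Variables (R : realType) (N : nat).
Local Notation C := (Cplx R).
Local Notation mu := (@lebesgue_measure R).
Local Notation pos := (`]0, +oo[%classic : set R).
Implicit Types (D : set R) (F : R -> 'M[C]_N) (W : 'M[C]_N).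

Lemma mxcoord_integral D F b i j :
  mxcoord b i j (mx_integral D F) = \int[mu]_(t in D) mxcoord b i j (F t).
Proof. by case: b; rewrite /mxcoord mxE. Qed.

Lemma mx_integrableP D F : mx_integrable D F <->
  forall b i j, mu.-integrable D (EFin \o (fun t => mxcoord b i j (F t))).
Proof.
split=> [h [] i j|h i j]; [by have [] := h i j|by have [] := h i j|].
by split; [exact: (h true)|exact: (h false)].
Qed.

Definition mx_measurable D F :=
  forall b i j, measurable_fun D (fun t => mxcoord b i j (F t)).

Lemma mx_integrable_measurable D F : mx_integrable D F -> mx_measurable D F.
Proof.
by move=> /mx_integrableP h b i j; have /integrableP[/measurable_EFinP] := h b i j.
Qed.

Lemma mx_continuous_measurable D F : measurable D -> D `<=` pos ->
  (forall t : R, 0 < t -> F @ t --> F t) -> mx_measurable D F.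
Proof.
move=> mD Dpos cF b i j; apply: pos_continuous_measurable => // t t0.
have /mx_cvg_coord := cF t t0; exact.
Qed.

Lemma eq_mx_integral D F G : {in D, F =1 G} -> mx_integral D F = mx_integral D G.
Proof.
move=> FG; apply: mxcoord_ext => b i j; rewrite !mxcoord_integral.
by apply: eq_Rintegral => t tD; rewrite FG.
Qed.

Lemma eq_mx_integrable D F G : measurable D ->
  {in D, F =1 G} -> mx_integrable D F -> mx_integrable D G.
Proof.
move=> mD FG /mx_integrableP h; apply/mx_integrableP => b i j.
by apply: eq_integrable (h b i j) => // t tD /=; rewrite FG.
Qed.

Lemma mx_le_integrable D F (g : R -> R) : measurable D -> mx_measurable D F ->
  (forall t, D t -> mxnorm1 (F t) <= g t) -> mu.-integrable D (EFin \o g) ->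
  mx_integrable D F.
Proof.
move=> mD mF Fg ig; apply/mx_integrableP => b i j.
apply: (le_Rintegrable mD (mF b i j) _ ig) => t Dt.
exact: le_trans (normr_mxcoord _ _ _ _) (Fg t Dt).
Qed.

Lemma mxnorm1_integral_le D F (g : R -> R) : measurable D -> mx_measurable D F ->
  (forall t, D t -> mxnorm1 (F t) <= g t) -> mu.-integrable D (EFin \o g) ->
  mxnorm1 (mx_integral D F) <= 2 * (N * N)%:R * \int[mu]_(t in D) g t.
Proof.
move=> mD mF Fg ig.
have /mx_integrableP iF := mx_le_integrable mD mF Fg ig.
apply: mxnorm1_coord_le.
  by apply: Rintegral_ge0 => t Dt; exact: le_trans (mxnorm1_ge0 _) (Fg t Dt).
move=> b i j; rewrite mxcoord_integral.
apply: le_trans; first by apply: le_normr_Rintegral => //; exact: iF.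
apply: le_Rintegral => //; first exact: integrable_abse (iF b i j).
by move=> t Dt; exact: le_trans (normr_mxcoord _ _ _ _) (Fg t Dt).
Qed.

Lemma mx_dominated_cvg D (F_ : nat -> R -> 'M[C]_N) F (g : R -> R) : measurable D ->
  (forall n, mx_measurable D (F_ n)) -> mx_measurable D F ->
  (forall t, D t -> F_ n t @[n --> \oo] --> F t) ->
  mu.-integrable D (EFin \o g) -> (forall n t, D t -> mxnorm1 (F_ n t) <= g t) ->
  mx_integrable D F /\ mx_integral D (F_ n) @[n --> \oo] --> mx_integral D F.
Proof.
move=> mD mF_ mF F_F ig F_g.
have h b i j : mu.-integrable D (EFin \o (fun t => mxcoord b i j (F t))) /\
   (\int[mu]_(t in D) mxcoord b i j (F_ n t)) @[n --> \oo] -->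
     \int[mu]_(t in D) mxcoord b i j (F t).
  apply: (Rintegral_dominated_cvg mD _ _ _ ig).
  - by move=> n; exact: mF_.
  - exact: mF.
  - by move=> t Dt; have /mx_cvg_coord := F_F t Dt; exact.
  - by move=> n t Dt; exact: le_trans (normr_mxcoord b i j _) (F_g n t Dt).
split; first by apply/mx_integrableP => b i j; case: (h b i j).
apply/mx_cvg_coord => b i j; rewrite mxcoord_integral.
under eq_fun do rewrite mxcoord_integral.
by case: (h b i j).
Qed.

Lemma RintegrableD D (f g : R -> R) : measurable D ->
  mu.-integrable D (EFin \o f) -> mu.-integrable D (EFin \o g) ->
  mu.-integrable D (EFin \o (fun t => f t + g t)).
Proof.
move=> mD intf intg.
by apply: (@eq_integrable _ _ _ mu D mD ((EFin \o f) \+ (EFin \o g))%E); [|exact: integrableD].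
Qed.

Lemma RintegrableZ D (f : R -> R) c : measurable D ->
  mu.-integrable D (EFin \o f) -> mu.-integrable D (EFin \o (fun t => c * f t)).
Proof.
move=> mD intf.
by apply: (@eq_integrable _ _ _ mu D mD (fun t => c%:E * (f t)%:E)%E); [|exact: integrableZl].
Qed.

Lemma Rintegrable_sum (I : Type) (r : seq I) (f : I -> R -> R) D : measurable D ->
  (forall i, mu.-integrable D (EFin \o f i)) ->
  mu.-integrable D (EFin \o (fun t => \sum_(i <- r) f i t)) /\
  \int[mu]_(t in D) (\sum_(i <- r) f i t) = \sum_(i <- r) \int[mu]_(t in D) f i t.
Proof.
move=> mD intf; elim: r => [|i r [IH1 IH2]].
  have -> : (fun t => \sum_(i <- [::]) f i t) = cst 0.
    by apply/funext => t; rewrite big_nil.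
  rewrite big_nil Rintegral_cst// mul0r; split => //; exact: integrable0.
have -> : (fun t => \sum_(i <- i :: r) f i t) = (fun t => f i t + \sum_(i <- r) f i t).
  by apply/funext => t; rewrite big_cons.
rewrite big_cons RintegralD// IH2; split=> //.
exact: RintegrableD.
Qed.

Lemma mx_integral_mull D F W : measurable D -> mx_integrable D F ->
  mx_integrable D (fun t => W *m F t) /\
  mx_integral D (fun t => W *m F t) = W *m mx_integral D F.
Proof.
move=> mD /mx_integrableP iF.
have iZ b i j c : mu.-integrable D (EFin \o (fun t => c * mxcoord b i j (F t))).
  exact: RintegrableZ.
have h b i j := @Rintegrable_sum _ (index_enum _) (fun k t =>
    mxcoord true i k W * mxcoord b k j (F t) +
    (-1) ^+ b * mxcoord false i k W * mxcoord (~~ b) k j (F t)) D mD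
   (fun k => RintegrableD mD (iZ b k j _) (iZ (~~ b) k j _)).
split.
  apply/mx_integrableP => b i j; under eq_fun do rewrite mxcoordM.
  by case: (h b i j).
apply: mxcoord_ext => b i j; rewrite mxcoord_integral mxcoordM.
under eq_Rintegral do rewrite mxcoordM.
rewrite (proj2 (h b i j)); apply: eq_bigr => k _.
by rewrite RintegralD ?RintegralZl ?mxcoord_integral//; exact: iZ.
Qed.

Lemma mx_integral_mulr D F W : measurable D -> mx_integrable D F ->
  mx_integrable D (fun t => F t *m W) /\
  mx_integral D (fun t => F t *m W) = mx_integral D F *m W.
Proof.
move=> mD /mx_integrableP iF.
have iZ b i j c : mu.-integrable D (EFin \o (fun t => mxcoord b i j (F t) * c)).
  by under eq_fun do rewrite mulrC; exact: RintegrableZ.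
have h b i j := @Rintegrable_sum _ (index_enum _) (fun k t =>
    mxcoord true i k (F t) * mxcoord b k j W +
    mxcoord false i k (F t) * ((-1) ^+ b * mxcoord (~~ b) k j W)) D mD
   (fun k => RintegrableD mD (iZ true i k _) (iZ false i k _)).
have E b i j M : mxcoord b i j (M *m W) = \sum_k (mxcoord true i k M * mxcoord b k j W +
    mxcoord false i k M * ((-1) ^+ b * mxcoord (~~ b) k j W)).
  by rewrite mxcoordM; apply: eq_bigr => k _; rewrite mulrCA mulrA.
split.
  apply/mx_integrableP => b i j; under eq_fun do rewrite E.
  by case: (h b i j).
apply: mxcoord_ext => b i j; rewrite mxcoord_integral E.
under eq_Rintegral do rewrite E.
rewrite (proj2 (h b i j)); apply: eq_bigr => k _.
by rewrite RintegralD ?RintegralZr ?mxcoord_integral//; exact: iZ.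
Qed.

Lemma mx_integralD D F G : measurable D -> mx_integrable D F -> mx_integrable D G ->
  mx_integrable D (fun t => F t + G t) /\
  mx_integral D (fun t => F t + G t) = mx_integral D F + mx_integral D G.
Proof.
move=> mD /mx_integrableP iF /mx_integrableP iG; split.
  apply/mx_integrableP => b i j; under eq_fun do rewrite mxcoordD.
  exact: RintegrableD.
apply: mxcoord_ext => b i j; rewrite mxcoord_integral mxcoordD !mxcoord_integral.
under eq_Rintegral do rewrite mxcoordD.
by rewrite RintegralD.
Qed.

Lemma mx_integralZ D F (c : R) : measurable D -> mx_integrable D F ->
  mx_integrable D (fun t => RtoC c *: F t) /\
  mx_integral D (fun t => RtoC c *: F t) = RtoC c *: mx_integral D F.
Proof.
move=> mD iF.
have [h1 h2] := mx_integral_mull (RtoC c)%:M mD iF.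
rewrite mul_scalar_mx in h2.
have E : (fun t => RtoC c *: F t) = (fun t => (RtoC c)%:M *m F t).
  by apply/funext => t; rewrite mul_scalar_mx.
by rewrite E.
Qed.

Lemma mx_integral_scal D (f : R -> R) W : measurable D -> mu.-integrable D (EFin \o f) ->
  mx_integrable D (fun t => RtoC (f t) *: W) /\
  mx_integral D (fun t => RtoC (f t) *: W) = RtoC (\int[mu]_(t in D) f t) *: W.
Proof.
move=> mD intf; split.
  apply/mx_integrableP => b i j; under eq_fun do rewrite mxcoordZ.
  by under eq_fun do rewrite mulrC; exact: RintegrableZ.
apply: mxcoord_ext => b i j; rewrite mxcoord_integral mxcoordZ.
under eq_Rintegral do rewrite mxcoordZ.
by rewrite RintegralZr.
Qed.

Lemma mx_integral_pinfty_cvg F : mx_integrable pos F ->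
  mx_integral `]0, T] F @[T --> +oo] --> mx_integral pos F.
Proof.
move=> /mx_integrableP iF; apply/mx_cvg_coord => b i j; rewrite mxcoord_integral.
under eq_fun do rewrite mxcoord_integral.
exact: Rintegral_pinfty_cvg.
Qed.

Lemma mx_integral_derive_pos (G F : R -> 'M[C]_N) :
  (forall t : R, 0 < t -> mx_is_derive G t (F t)) ->
  (forall t : R, 0 < t -> F @ t --> F t) ->
  G n.+2%:R^-1 @[n --> \oo] --> (0 : 'M[C]_N) -> G n.+2%:R @[n --> \oo] --> (0 : 'M[C]_N) ->
  mx_integrable pos F -> mx_integral pos F = 0.
Proof.
move=> dG cF /mx_cvg_coord G0 /mx_cvg_coord Goo /mx_integrableP iF.
apply: mxcoord_ext => b i j; rewrite mxcoord_integral mxcoord0.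
rewrite -[RHS](subrr 0); apply: (@Rintegral_derive_pos R (fun t => mxcoord b i j (G t))) => //.
- by move=> t t0; exact: dG.
- by move=> t t0; have /mx_cvg_coord := cF t t0; exact.
- by have := G0 b i j; rewrite mxcoord0.
- by have := Goo b i j; rewrite mxcoord0.
Qed.

Lemma mx_Abel_integral F (I : 'M[C]_N) (d : nat -> R) :
  (forall t : R, 0 < t -> F @ t --> F t) ->
  (forall T : R, mx_integrable `]0, T] F) ->
  mx_integral `]0, T] F @[T --> +oo] --> I ->
  (forall n, 0 < d n) -> d n @[n --> \oo] --> 0 ->
  (forall n, mx_integrable pos (fun t => RtoC (expR (- d n * t)) *: F t)) ->
  mx_integral pos (fun t => RtoC (expR (- d n * t)) *: F t) @[n --> \oo] --> I.
Proof.
move=> cF iF /mx_cvg_coord FI d0 dc idF; apply/mx_cvg_coord => b i j.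
have -> : (fun n => mxcoord b i j (mx_integral pos (fun t => RtoC (expR (- d n * t)) *: F t)))
    = (fun n => \int[mu]_(t in pos) (expR (- d n * t) * mxcoord b i j (F t))).
  apply/funext => n; rewrite mxcoord_integral.
  by apply: eq_Rintegral => t _; rewrite mxcoordZ.
apply: Abel_integral => //.
- by move=> t t0; have /mx_cvg_coord := cF t t0; exact.
- by move=> T; have /mx_integrableP := iF T; exact.
- by have := FI b i j; under eq_fun do rewrite mxcoord_integral.
- move=> n; have /mx_integrableP/(_ b i j) := idF n.
  congr (_.-integrable _ (_ \o _)).
  by apply/funext => t; rewrite mxcoordZ.
Qed.

End MatrixIntegrals.

(** * Moments of the Gamma kernel *)

Section GammaLimits.
Variable R : realType.

Lemma cvg_expR_pinfty0 (u : nat -> R) : u n @[n --> \oo] --> +oo ->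
  expR (- u n) @[n --> \oo] --> 0.
Proof. by move=> uoo; apply: cvg_comp uoo (@cvgr_expR R). Qed.

Lemma cvg_expR_gker_pinfty (p c : R) : 0 < p -> 0 < c ->
  expR (p * ln n.+2%:R - c * n.+2%:R) @[n --> \oo] --> 0.
Proof.
move=> p0 c0; under eq_fun do rewrite -opprB.
apply: cvg_expR_pinfty0; apply/cvgryPge => M.
(* With p eta = c/2, the inequality ln y <= y - 1 at y = eta (n + 2) lets half of the linear term
   absorb the logarithm; the other half tends to infinity. *)
pose eta := c / (2 * p).
have eta0 : 0 < eta by rewrite divr_gt0// mulr_gt0.
have h n : p * ln n.+2%:R <= c / 2 * n.+2%:R - p * (1 + ln eta).
  have : ln (eta * n.+2%:R) <= eta * n.+2%:R - 1.
    have := @le_ln1Dx _ (eta * n.+2%:R - 1); rewrite addrCA subrr addr0; apply.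
    by rewrite ltrBrDl subrr mulr_gt0.
  rewrite lnM ?posrE// => h.
  have -> : c / 2 = p * eta by rewrite /eta; field; rewrite gt_eqF.
  have {h} : p * (ln eta + ln n.+2%:R) <= p * (eta * n.+2%:R - 1) by rewrite ler_wpM2l// ltW.
  lra.
near=> n.
have hn : (M - p * (1 + ln eta)) / (c / 2) <= n.+2%:R.
  apply: (@le_trans _ _ n%:R); last by rewrite ler_nat -addn2 leq_addr.
  by near: n; exact: nbhs_infty_ger.
move: hn; rewrite ler_pdivrMr ?divr_gt0// => hn.
by have := h n; lra.
Unshelve. all: by end_near. Qed.

Lemma cvg_expR_gker_0 (p c : R) : 0 < p -> 0 < c ->
  expR (p * ln n.+2%:R^-1 - c * n.+2%:R^-1) @[n --> \oo] --> 0.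
Proof.
move=> p0 c0; under eq_fun do rewrite -opprB.
apply: cvg_expR_pinfty0; apply/cvgryPge => M.
near=> n.
have hn : expR (M / p) <= n.+2%:R.
  apply: (@le_trans _ _ n%:R); last by rewrite ler_nat -addn2 leq_addr.
  by near: n; exact: nbhs_infty_ger.
rewrite lnV ?posrE// mulrN opprK.
have : M / p <= ln n.+2%:R by rewrite -ler_expR lnK ?posrE.
rewrite ler_pdivrMr// => h.
have : 0 <= c * n.+2%:R^-1 :> R by rewrite mulr_ge0 ?invr_ge0 ?ltW.
move: h; set v := (n.+2%:R)^-1; set l := ln _ => h w; rewrite [p * l]mulrC; lra.
Unshelve. all: by end_near. Qed.

End GammaLimits.

Section MatrixGamma.
Variables (R : realType) (N : nat).
Local Notation C := (Cplx R).
Local Notation mu := (@lebesgue_measure R).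
Local Notation pos := (`]0, +oo[%classic : set R).
Implicit Types (A M W : 'M[C]_N) (q c t : R).

(* t^(A + (q-1) I) e^(-c t) for t > 0 *)
Definition mker A q c t : 'M[C]_N := RtoC (gker q c t) *: expmx (RtoC (ln t) *: A).

Lemma gamma_kernelE A t : 0 < t -> gamma_kernel A t = mker A 0 1 t.
Proof.
move=> t0; rewrite /gamma_kernel /powmx /mker.
have -> : A - 1%:M = A + (RtoC (-1 : R))%:M by rewrite RtoCN raddfN.
rewrite expmx_shift scalerA -RtoCM; congr (RtoC _ *: _).
by rewrite /gker mul0r sub0r !mulN1r mul1r [expR (- ln t)]expRN lnK.
Qed.

(** Powers of t shift [q] and regularizing exponentials shift [c], so all integrands built from the
    kernel stay in one two-parameter family while [A] is fixed. *)
Lemma mkerXM A q c d t (n : nat) : 0 < t ->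
  RtoC (t ^+ n) *: (RtoC (expR (- d * t)) *: mker A q c t) = mker A (n%:R + q) (d + c) t.
Proof.
move=> t0; rewrite /mker !scalerA -!RtoCM; congr (RtoC _ *: _).
rewrite -mulrA -[expR _ * gker _ _ _]/(_ * _).
have -> : - d * t = 0 * ln t - d * t by rewrite mul0r sub0r mulNr.
by rewrite gkerM gkerXM// add0r.
Qed.

Lemma mx_is_derive_powmx A t : 0 < t ->
  mx_is_derive (fun t => expmx (RtoC (ln t) *: A)) t (RtoC t^-1 *: (A *m expmx (RtoC (ln t) *: A))).
Proof.
move=> t0; apply: (@mx_is_derive_comp _ _ (fun t => expmx (RtoC t *: A)) (@ln R)).
- exact: is_derive1_ln.
- exact: mx_is_derive_expmx.
Qed.

Lemma mker_cvg A q c t : 0 < t -> mker A q c @ t --> mker A q c t.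
Proof.
move=> t0; apply: mx_cvgZ; first exact: continuous_gker.
exact: mx_is_derive_cvg (mx_is_derive_powmx A t0).
Qed.

Lemma mker_norm_le A : Re_pos A ->
  exists K p p' : R, [/\ 0 <= K, 0 < p, 0 < p' & forall q c t, 0 < t ->
    mxnorm1 (mker A q c t) <= K * (gker (q + p) c t + gker (q + p') c t)].
Proof.
move=> /expmx_growth[K [p [p' [K0 p0 p'0 hK]]]].
exists K, p, p'; split=> // q c t t0.
rewrite mxnorm1ZR ger0_norm ?gker_ge0//.
apply: (le_trans (ler_wpM2l (gker_ge0 _ _ t0) (hK _))).
rewrite mulrCA mulrDr; have E a : gker q c t * expR (a * ln t) = gker (q + a) c t.
  by rewrite mulrC -[a * ln t]subr0 -(mul0r t) gkerM add0r addrC.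
by rewrite !E.
Qed.

Lemma integrable_gker_add (K p p' c : R) : 0 < p -> 0 < p' -> 0 < c ->
  mu.-integrable pos (EFin \o (fun t => K * (gker p c t + gker p' c t))).
Proof.
move=> p0 p'0 c0; apply: RintegrableZ => //.
by apply: RintegrableD => //; exact: integrable_gker.
Qed.

Lemma mx_integrable_mker A q c : Re_pos A -> 0 <= q -> 0 < c -> mx_integrable pos (mker A q c).
Proof.
move=> /mker_norm_le[K [p [p' [K0 p0 p'0 hK]]]] q0 c0.
apply: (mx_le_integrable _ _ _ (@integrable_gker_add K (q + p) (q + p') c _ _ _)) => //.
- apply: mx_continuous_measurable => // t; exact: mker_cvg.
- by move=> t /=; rewrite in_itv/= andbT; exact: hK.
- by rewrite ltr_wpDl.
- by rewrite ltr_wpDl.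
Qed.

Definition mmoment A q c : 'M[C]_N := mx_integral pos (mker A q c).

(** The difference of the two sides is the integral of the derivative of t^(A+qI) e^(-ct). This
    function vanishes at infinity by the exponential, and at 0 by the spectral condition, even for q
    = 0. *)
Lemma mmoment_rec A q c : Re_pos A -> 0 <= q -> 0 < c ->
  RtoC c *: mmoment A (q + 1) c = (A + (RtoC q)%:M) *m mmoment A q c.
Proof.
move=> hA q0 c0.
have q10 : 0 <= q + 1 by rewrite addr_ge0.
have i1 := mx_integrable_mker hA q0 c0.
have i2 := mx_integrable_mker hA q10 c0.
have [j1 e1] := mx_integral_mull (A + (RtoC q)%:M) (measurable_itv _) i1.
have [j2 e2] := mx_integralZ (- c) (measurable_itv _) i2.
have [j3 e3] := mx_integralD (measurable_itv _) j1 j2.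
apply/esym/eqP; rewrite -subr_eq0 -scaleNr -RtoCN /mmoment -e1 -e2 -e3; apply/eqP.
pose s t : R := expR (q * ln t - c * t).
have [K [p [p' [K0 p0 p'0 hK]]]] := expmx_growth hA.
have sY t : mxnorm1 (RtoC (s t) *: expmx (RtoC (ln t) *: A)) <=
    K * (expR ((q + p) * ln t - c * t) + expR ((q + p') * ln t - c * t)).
  rewrite mxnorm1ZR ger0_norm ?expR_ge0//.
  apply: (le_trans (ler_wpM2l (expR_ge0 _) (hK _))).
  rewrite mulrCA mulrDr -!expRD le_eqVlt; apply/orP; left; apply/eqP.
  by congr (_ * (expR _ + expR _)); ring.
have lim0 (u : nat -> R) :
    (forall b, 0 < b -> expR (b * ln (u n) - c * u n) @[n --> \oo] --> 0) ->
    RtoC (s (u n)) *: expmx (RtoC (ln (u n)) *: A) @[n --> \oo] --> (0 : 'M[C]_N).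
  move=> hu; apply: (mx_squeeze0 (fun n => sY (u n))).
  have -> : 0 = K * (0 + 0) by rewrite addr0 mulr0.
  by apply: cvgMr; apply: cvgD; apply: hu; rewrite ltr_wpDl.
apply: (@mx_integral_derive_pos _ _ (fun t => RtoC (s t) *: expmx (RtoC (ln t) *: A))) => //.
- move=> t t0.
  have ds : is_derive t 1 s (s t * (q / t - c)).
    have h := is_deriveB (is_deriveZ q (is_derive1_ln t0)) (is_deriveZ c (is_derive_id t 1)).
    have h' := @is_derive1_comp _ expR (q \*: @ln R - c \*: id) t _ _ (is_derive_expR _) h.
    apply: is_derive_eq h' _.
    by rewrite /GRing.scale/= mulr1.
  apply: mx_is_derive_eq (mx_is_deriveZ ds (mx_is_derive_powmx A t0)) _.
  rewrite /mker; set Y := expmx _.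
  have -> : gker (q + 1) c t = s t.
    rewrite /gker mulrDl mul1r addrAC expRD lnK// mulfK// gt_eqF//.
  rewrite -scalemxAr mulmxDl mul_scalar_mx scalerDr !scalerA -!RtoCM /gker -/(s t).
  have -> : s t * (q / t - c) = s t / t * q + (- c) * s t by ring.
  have aux (X V Z : 'M[C]_N) : X + V + Z = Z + X + V by rewrite addrC addrA.
  rewrite RtoCD scalerDl; exact: aux.
- move=> t t0; apply: mx_cvgD.
  + by apply: mx_cvg_mull; exact: mker_cvg.
  + by apply: mx_cvgZ; [exact: cvg_cst|exact: mker_cvg].
- by apply: lim0 => b b0; exact: cvg_expR_gker_0.
- by apply: lim0 => b b0; exact: cvg_expR_gker_pinfty.
Qed.

Lemma poch_recr A l : poch A l.+1 = poch A l *m (A + (l%:R)%:M).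
Proof. by rewrite /poch big_ord_recr. Qed.

Lemma comm_mx_poch A M l : comm_mx M A -> comm_mx M (poch A l).
Proof.
move=> MA; apply: (@commr_prod _ _ _ _ _ M) => k _.
by apply: comm_mxD => //; exact: comm_mx_scalar.
Qed.

Lemma mmoment_poch A c l : Re_pos A -> 0 < c ->
  mmoment A l%:R c = RtoC (c^-1 ^+ l) *: (poch A l *m mmoment A 0 c).
Proof.
move=> hA c0; elim: l => [|l IH].
  have -> : poch A 0 = 1%:M by rewrite /poch big_ord0.
  by rewrite expr0 RtoC1 scale1r mul1mx.
have h := mmoment_rec hA (ler0n _ l) c0.
rewrite poch_recr exprS RtoCM -scalerA -natr1.
have -> : mmoment A (l%:R + 1) c = RtoC c^-1 *: (RtoC c *: mmoment A (l%:R + 1) c).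
  by rewrite scalerA -RtoCM mulVf ?gt_eqF// RtoC1 scale1r.
congr (_ *: _); rewrite h IH -scalemxAr mulmxA RtoC_nat; congr (_ *: (_ *m _)).
apply: comm_mx_poch; apply: comm_mx_sym; apply: comm_mxD => //.
exact: comm_mx_scalar.
Qed.

Lemma comm_mx_mmoment A M q c : Re_pos A -> 0 <= q -> 0 < c -> comm_mx M A ->
  comm_mx M (mmoment A q c).
Proof.
move=> hA q0 c0 MA; have iA := mx_integrable_mker hA q0 c0.
rewrite /comm_mx /mmoment -(proj2 (mx_integral_mull M (measurable_itv _) iA)).
rewrite -(proj2 (mx_integral_mulr M (measurable_itv _) iA)).
apply: eq_mx_integral => t _.
by rewrite /mker -scalemxAr -scalemxAl (comm_mx_expmx _ MA).
Qed.

Lemma gamma_kernel_integral_cvg A : Re_pos A ->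
  mx_integral `]0, T] (gamma_kernel A) @[T --> +oo] --> mmoment A 0 1.
Proof.
move=> hA.
have h := mx_integral_pinfty_cvg (mx_integrable_mker hA (lexx 0) ltr01).
apply: cvg_trans h; apply: near_eq_cvg; apply: nearW => T.
apply: eq_mx_integral => t; rewrite inE/= in_itv/= => /andP[t0 _].
by rewrite gamma_kernelE.
Qed.

Lemma GammaE A : Re_pos A -> Gamma A = mmoment A 0 1.
Proof. by move=> hA; apply: mx_cvg_lim; exact: gamma_kernel_integral_cvg. Qed.

End MatrixGamma.

(** * Invertibility of the matrix Gamma function *)

Section ScalarGamma.
Variable R : realType.
Local Notation mu := (@lebesgue_measure R).
Local Notation pos := (`]0, +oo[%classic : set R).

(** The scalar Gamma function, for q > 0. *)
Definition gint (q : R) : R := \int[mu]_(t in pos) gker q 1 t.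

Lemma gint_rec (q : R) : 0 < q -> gint (q + 1) = q * gint q.
Proof.
move=> q0; have q10 : 0 < q + 1 by rewrite addr_gt0.
have i1 := integrable_gker q0 ltr01.
have i2 := integrable_gker q10 ltr01.
have i1' := RintegrableZ q (measurable_itv _) i1.
have i2' := RintegrableZ (-1) (measurable_itv _) i2.
have i3 := RintegrableD (measurable_itv _) i1' i2'.
apply/eqP; rewrite eq_sym -subr_eq0 -mulN1r /gint -!RintegralZl// -RintegralD//.
apply/eqP; rewrite -[RHS](subrr 0).
apply: (@Rintegral_derive_pos R (fun t => expR (q * ln t - 1 * t))) => //.
- move=> t t0.
  have h := is_deriveB (is_deriveZ q (is_derive1_ln t0)) (is_deriveZ 1 (is_derive_id t 1)).
  have h' := @is_derive1_comp _ expR (q \*: @ln R - 1 \*: id) t _ _ (is_derive_expR _) h.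
  apply: is_derive_eq h' _.
  have -> : gker (q + 1) 1 t = expR (q * ln t - 1 * t).
    by rewrite /gker [(q + 1) * _]mulrDl mul1r addrAC expRD lnK// mulfK// gt_eqF.
  rewrite /GRing.scale/= /gker !mulr1 -[X in expR X * _]/(q * ln t - 1 * t).
  ring.
- move=> t t0; apply: cvgD; apply: cvgMr; exact: continuous_gker.
- exact: cvg_expR_gker_0.
- exact: cvg_expR_gker_pinfty.
Qed.

Lemma gint1 : gint 1 = 1.
Proof.
transitivity (0 - (- 1) : R); last by rewrite sub0r opprK.
apply: (@Rintegral_derive_pos R (fun t => - expR (- t))) => //.
- move=> t t0.
  have h := is_deriveN (is_derive1_comp (is_derive_expR (- t)) (is_deriveNid t 1)).
  apply: is_derive_eq h _.
  by rewrite /gker !mul1r mulrN1 opprK expRD lnK// mulrAC mulfV ?mul1r// gt_eqF.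
- by move=> t t0; exact: continuous_gker.
- apply: cvgN; rewrite -[X in _ --> X]expR0; apply: continuous_cvg; first exact: continuous_expR.
  rewrite -[X in _ --> X]oppr0; apply: cvgN.
  have := @cvg_harmonic R; rewrite -(cvg_shiftn 1).
  by under eq_fun do rewrite /harmonic/= addn1.
- rewrite -[X in _ --> X]oppr0; apply: cvgN; apply: cvg_expR_pinfty0.
  apply/cvgryPge => M; near=> n.
  apply: (@le_trans _ _ n%:R); last by rewrite ler_nat -addn2 leq_addr.
  by near: n; exact: nbhs_infty_ger.
- exact: integrable_gker.
Unshelve. all: by end_near. Qed.

Lemma gint_shift (q : R) (k : nat) : 0 < q ->
  gint (q + k%:R) = gint q * \prod_(i < k) (q + i%:R).
Proof.
move=> q0; elim: k => [|k IH]; first by rewrite addr0 big_ord0 mulr1.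
rewrite -natr1 addrA gint_rec; last by rewrite ltr_wpDr.
by rewrite IH big_ord_recr/= mulrC mulrA.
Qed.

Lemma gint_nat_gt0 (n : nat) : 0 < gint n.+1%:R.
Proof.
rewrite -nat1r gint_shift// gint1 mul1r; apply: prodr_gt0 => i _.
by rewrite ltr_wpDr.
Qed.

Lemma cvg_ratio_nat (a b : nat) :
  ((m + a).+1%:R / (m + b).+1%:R : R) @[m --> \oo] --> (1 : R).
Proof.
have h : ((m + b).+1%:R^-1 : R) @[m --> \oo] --> (0 : R).
  by have := @cvg_harmonic R; rewrite -(cvg_shiftn b).
have -> : (fun m => (m + a).+1%:R / (m + b).+1%:R : R) =
          (fun m => 1 + (a%:R - b%:R) * (m + b).+1%:R^-1).
  apply/funext => m; have mb0 : (m + b).+1%:R != 0 :> R by rewrite pnatr_eq0.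
  have -> : (m + a).+1%:R = (m + b).+1%:R + (a%:R - b%:R) :> R.
    by rewrite -!natr1 !natrD; ring.
  by rewrite mulrDl mulfV.
rewrite -[X in _ --> X]addr0; apply: cvgD; first exact: cvg_cst.
by rewrite -[X in _ --> X](mulr0 (a%:R - b%:R)); apply: cvgMr.
Qed.

Lemma cvg_prod_ratio_nat (k : nat) (a b : 'I_k -> nat) :
  (\prod_(i < k) ((m + a i).+1%:R / (m + b i).+1%:R) : R) @[m --> \oo] --> (1 : R).
Proof.
rewrite -[X in _ --> X](_ : \prod_(i < k) (1 : R) = 1); last by rewrite big1.
have mulc (x : R * R) : {for x, continuous (fun y : R * R => y.1 * y.2)}.
  exact: mul_continuous.
by apply: (cvg_big mulc) => i _; exact: cvg_ratio_nat.
Qed.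

(** With n = m + k + 1, this is the mean of (t/n)^k under the density t^(n-1) e^(-t) / (n-1)!; it
    equals the product of the ratios (n + i)/n for i < k. *)
Lemma gint_ratio_up (k : nat) :
  (expR (- (k%:R * ln (m + k).+1%:R)) * gint ((m + k).+1%:R + k%:R) / gint (m + k).+1%:R)
    @[m --> \oo] --> (1 : R).
Proof.
apply: cvg_trans (cvg_prod_ratio_nat (fun i : 'I_k => (k + i)%N) (fun=> k)).
apply: near_eq_cvg; apply: nearW => m.
have g0 := gint_nat_gt0 (m + k).
rewrite gint_shift// mulrA mulrAC mulfK ?gt_eqF//.
have -> : expR (- (k%:R * ln (m + k).+1%:R)) = \prod_(i < k) (m + k).+1%:R^-1 :> R.
  by rewrite expRN -expRB_ln// prodr_const card_ord exprVn.
rewrite -big_split/=; apply: eq_bigr => i _.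
by rewrite mulrC -natrD addSn addnA.
Qed.

(** The mean of (t/n)^(-k) under the same density. Taking n = m + k + 1 keeps n - k >= 1, where the
    kernel is integrable. *)
Lemma gint_ratio_down (k : nat) :
  (expR (k%:R * ln (m + k).+1%:R) * gint ((m + k).+1%:R - k%:R) / gint (m + k).+1%:R)
    @[m --> \oo] --> (1 : R).
Proof.
apply: cvg_trans (cvg_prod_ratio_nat (fun=> k) (fun i : 'I_k => i)).
apply: near_eq_cvg; apply: nearW => m.
have g0 := gint_nat_gt0 m.
have -> : (m + k).+1%:R - k%:R = m.+1%:R :> R by rewrite -addSn natrD addrK.
have -> : gint (m + k).+1%:R = gint m.+1%:R * \prod_(i < k) (m + i).+1%:R.
  rewrite -addSn natrD gint_shift//; congr (_ * _).
  by apply: eq_bigr => i _; rewrite -natrD.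
rewrite invfM mulrA mulfK ?gt_eqF// -prodfV.
have -> : expR (k%:R * ln (m + k).+1%:R) = \prod_(i < k) (m + k).+1%:R :> R.
  by rewrite -expRB_ln// prodr_const card_ord.
by rewrite -big_split.
Qed.

End ScalarGamma.

(** * Deviation of the matrix exponential from the identity *)

Section GammaUnit.
Variables (R : realType) (N : nat).
Local Notation C := (Cplx R).
Local Notation mu := (@lebesgue_measure R).
Local Notation pos := (`]0, +oo[%classic : set R).
Implicit Types (A M W : 'M[C]_N).

(** Termwise comparison with the exponential series once the term of index 0 is removed. A bound [a]
    replaces the norm so that a natural number can be inserted, which makes the relevant moments
    computable by the Gamma recursion. *)
Lemma expmx_sub1_le A (t a : R) : mxnorm1 A <= a ->
  mxnorm1 (expmx (RtoC t *: A) - 1%:M) <= mxnorm1 (1%:M : 'M[C]_N) * (expR (a * `|t|) - 1).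
Proof.
move=> Aa; set u := fun k => (k`!%:R)^-1 *: (RtoC t *: A) ^+ k.
have a0 : 0 <= a by exact: le_trans (mxnorm1_ge0 A) Aa.
have hu : series u n - 1%:M @[n --> \oo] --> expmx (RtoC t *: A) - 1%:M.
  apply: (@mx_cvgD _ _ _ _ _ (series u) (fun=> - 1%:M)); first exact: is_cvg_expmx.
  exact: cvg_cst.
apply: (mx_cvg_norm_le hu); near=> n.
have n0 : (0 < n)%N by near: n; exists 1.
rewrite /series/= big_ltn// {1}/u expr0 fact0 invr1 scale1r [1]/(1%:M) addrC addKr.
apply: (le_trans (mxnorm1_sum _ _ _)).
apply: (@le_trans _ _ (\sum_(1 <= k < n) mxnorm1 (1%:M : 'M[C]_N) * exp_coeff (a * `|t|) k)).
  apply: ler_sum => k _; apply: expmx_term_le; apply: (le_trans (mxnorm1X _ _)).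
  rewrite ler_wpM2l ?mxnorm1_ge0// lerXn2r ?nnegrE ?mxnorm1_ge0//.
rewrite -mulr_sumr ler_wpM2l ?mxnorm1_ge0// lerBrDr.
have -> : \sum_(1 <= k < n) exp_coeff (a * `|t|) k + 1 = series (exp_coeff (a * `|t|)) n.
  by rewrite /series/= [RHS]big_ltn// /exp_coeff/= expr0 fact0 divr1 addrC.
rewrite /expR; apply: nondecreasing_cvgn_le; last exact: is_cvg_series_exp_coeff.
by apply: nondecreasing_series => k _ _; rewrite exp_coeff_ge0// mulr_ge0.
Unshelve. all: by end_near. Qed.

(* AM-GM: [y <= eta + y^2 / (4 eta)] for [y = expR (b * `|t|) - 1]. *)
Lemma expR_normr_sub1_le (b t eta : R) : 0 <= b -> 0 < eta ->
  expR (b * `|t|) - 1 <=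
  eta + (1 + (4 * eta)^-1) * (expR (b * t) + expR (- (b * t)) - 2).
Proof.
move=> b0 eta0.
(* The sum on the left is even in t. At t replaced by ln t - ln n and b = k, it becomes (t/n)^k +
   (t/n)^(-k), free of absolute values. *)
have -> : expR (b * t) + expR (- (b * t)) = expR (b * `|t|) + (expR (b * `|t|))^-1.
  have [t0|t0] := leP 0 t; first by rewrite ger0_norm// expRN.
  by rewrite (ltr0_norm t0) mulrN expRN invrK addrC.
have : 1 <= expR (b * `|t|) by rewrite -expR0 ler_expR mulr_ge0.
set X := expR _ => X1; have X0 : 0 < X by exact: lt_le_trans X1.
rewrite -subr_ge0.
(* As X + X^-1 - 2 = (X - 1)^2 / X, clearing the denominator [X] leaves a square plus a nonnegative
   term. *)
have -> : eta + (1 + (4 * eta)^-1) * (X + X^-1 - 2) - (X - 1) =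
  (eta * (X - 1) + (X - 1 - 2 * eta) ^+ 2 / (4 * eta)) / X.
  by field; rewrite !gt_eqF.
rewrite divr_ge0 ?(ltW X0)// addr_ge0//; first by rewrite mulr_ge0 ?subr_ge0// ltW.
by rewrite divr_ge0 ?sqr_ge0// mulr_ge0// ltW.
Qed.

End GammaUnit.

(** * Separation by moments *)

Section GammaInvertible.
Variables (R : realType) (N : nat).
Local Notation C := (Cplx R).
Local Notation mu := (@lebesgue_measure R).
Local Notation pos := (`]0, +oo[%classic : set R).
Implicit Types (A M W : 'M[C]_N).

(* Under the probability density t^(n-1) e^(-t) / (n-1)!, the variable t / n
   concentrates at 1, so the mean of (t / n)^A tends to the identity; the
   deviation is controlled by the moments of order n + k and n - k. *)
Lemma mmoment_normalized_le A W (k m : nat) (eta : R) : Re_pos A ->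
  mxnorm1 A <= k%:R -> 0 < eta ->
  W *m mmoment A (m + k).+1%:R 1 = 0 ->
  mxnorm1 W <= 2 * (N * N)%:R * (mxnorm1 (1%:M : 'M[C]_N) * mxnorm1 W) *
    (eta + (1 + (4 * eta)^-1) *
     (expR (- (k%:R * ln (m + k).+1%:R)) * gint ((m + k).+1%:R + k%:R) / gint (m + k).+1%:R +
      expR (k%:R * ln (m + k).+1%:R) * gint ((m + k).+1%:R - k%:R) / gint (m + k).+1%:R - 2)).
Proof.
move=> hA Ak eta0 WA; set n := (m + k).+1%:R : R in WA *.
set nu := mxnorm1 1%:M; set w := mxnorm1 W; set K := 1 + (4 * eta)^-1.
have n0 : 0 < n by rewrite ltr0n.
have nk0 : 0 < n + k%:R by rewrite ltr_wpDr.
have nmk0 : 0 < n - k%:R.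
  by rewrite /n -addSn natrD addrK ltr0n.
have gn0 : 0 < gint n by exact: gint_nat_gt0.
have pm : measurable pos by exact: measurable_itv.
pose X0 := expmx (RtoC (- ln n) *: A).
(* [X0] is n^(-A). [F1] integrates to -Gamma(n) W and [F2] to 0 by the hypothesis on [W], while F1 +
   F2 is W ((t/n)^A - I) times the scalar kernel: W is recovered from a mean deviation. *)
pose F1 t := RtoC (gker n 1 t) *: (- W).
pose F2 t := (W *m mker A n 1 t) *m X0.
have iA := mx_integrable_mker hA (ltW n0) ltr01.
have [i2 e2] := mx_integral_mull W pm iA.
have [j2 f2] := mx_integral_mulr X0 pm i2.
have [j1 f1] := mx_integral_scal (- W) pm (integrable_gker n0 ltr01).
have [j3 f3] := mx_integralD pm j1 j2.
pose a := nu * w * (eta - 2 * K); pose b := nu * w * K * expR (- (k%:R * ln n)).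
pose c := nu * w * K * expR (k%:R * ln n).
pose g t := a * gker n 1 t + (b * gker (n + k%:R) 1 t + c * gker (n - k%:R) 1 t).
have ia := integrable_gker n0 ltr01.
have ib := integrable_gker nk0 ltr01.
have ic := integrable_gker nmk0 ltr01.
have ib' := RintegrableZ b pm ib.
have ic' := RintegrableZ c pm ic.
have ia' := RintegrableZ a pm ia.
have ibc := RintegrableD pm ib' ic'.
have ig := RintegrableD pm ia' ibc.
have gE : \int[mu]_(t in pos) g t = a * gint n + (b * gint (n + k%:R) + c * gint (n - k%:R)).
  by rewrite /g RintegralD// RintegralD// !RintegralZl.
have nrm : mxnorm1 (mx_integral pos (fun t => F1 t + F2 t)) <=
    2 * (N * N)%:R * \int[mu]_(t in pos) g t.
  apply: mxnorm1_integral_le => //; first exact: mx_integrable_measurable j3.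
  move=> t /=; rewrite in_itv/= andbT => t0.
  have -> : F1 t + F2 t =
      RtoC (gker n 1 t) *: (W *m (expmx (RtoC (ln t - ln n) *: A) - 1%:M)).
    rewrite /F1 /F2 /mker -scalemxAr -scalemxAl -scalerDr; congr (_ *: _).
    by rewrite expmx_add mulmxBr mulmx1 mulmxA addrC.
  rewrite mxnorm1ZR ger0_norm ?gker_ge0//.
  have h1 : mxnorm1 (W *m (expmx (RtoC (ln t - ln n) *: A) - 1%:M)) <=
      nu * w * (eta + K * (expR (k%:R * (ln t - ln n)) + expR (- (k%:R * (ln t - ln n))) - 2)).
    apply: (le_trans (mxnorm1M _ _)); rewrite [nu * w]mulrC -mulrA.
    rewrite ler_wpM2l ?mxnorm1_ge0//; apply: (le_trans (expmx_sub1_le _ Ak)).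
    by rewrite ler_wpM2l ?mxnorm1_ge0//; exact: expR_normr_sub1_le.
  apply: (le_trans (ler_wpM2l (gker_ge0 _ _ t0) h1)).
  have E1 : gker (n + k%:R) 1 t = expR (k%:R * ln t) * gker n 1 t.
    by rewrite -[k%:R * ln t]subr0 -(mul0r t) gkerM add0r addrC.
  have E2 : gker (n - k%:R) 1 t = expR (- (k%:R * ln t)) * gker n 1 t.
    by rewrite -[- (k%:R * ln t)]subr0 -(mul0r t) -mulNr gkerM add0r addrC.
  rewrite le_eqVlt; apply/orP; left; apply/eqP.
  have -> : expR (k%:R * (ln t - ln n)) = expR (k%:R * ln t) * expR (- (k%:R * ln n)).
    by rewrite -expRD; congr expR; ring.
  have -> : expR (- (k%:R * (ln t - ln n))) = expR (- (k%:R * ln t)) * expR (k%:R * ln n).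
    by rewrite -expRD; congr expR; ring.
  rewrite /g E1 E2 /a /b /c; ring.
rewrite f3 f1 f2 e2 -/(mmoment A n 1) WA mul0mx addr0 mxnorm1ZR mxnorm1N in nrm.
rewrite (gtr0_norm gn0) gE in nrm.
rewrite -(@ler_pM2l _ (gint n))//; apply: (le_trans nrm).
rewrite le_eqVlt; apply/orP; left; apply/eqP.
by rewrite /a /b /c; field; rewrite !gt_eqF.
Qed.

Lemma mmoment_separating A W : Re_pos A ->
  (forall n : nat, W *m mmoment A n%:R 1 = 0) -> W = 0.
Proof.
move=> hA WA; apply: mxnorm1_eq0.
have [k Ak] : exists k : nat, mxnorm1 A <= k%:R.
  by exists (Num.bound (mxnorm1 A)); exact: ltW (archi_boundP (mxnorm1_ge0 A)).
set w := mxnorm1 W; have w0 : 0 <= w by exact: mxnorm1_ge0.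
pose D := 2 * (N * N)%:R * mxnorm1 (1%:M : 'M[C]_N).
have D0 : 0 <= D by rewrite !mulr_ge0// mxnorm1_ge0.
(* Both moment ratios tend to 1, so in the limit only w <= D eta w survives. This [eta] makes D eta
   <= 1/2, which forces w = 0; the added 1 covers D = 0. *)
pose eta := (2 * (D + 1))^-1.
have D1 : 0 < 2 * (D + 1) by rewrite mulr_gt0// ltr_wpDl.
have eta0 : 0 < eta by rewrite invr_gt0.
have wle : w <= 2 * (N * N)%:R * (mxnorm1 (1%:M : 'M[C]_N) * w) *
    (eta + (1 + (4 * eta)^-1) * (1 + 1 - 2)).
  have lim : 2 * (N * N)%:R * (mxnorm1 (1%:M : 'M[C]_N) * w) *
    (eta + (1 + (4 * eta)^-1) *
     (expR (- (k%:R * ln (m + k).+1%:R)) * gint ((m + k).+1%:R + k%:R) / gint (m + k).+1%:R +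
      expR (k%:R * ln (m + k).+1%:R) * gint ((m + k).+1%:R - k%:R) / gint (m + k).+1%:R - 2))
    @[m --> \oo] --> 2 * (N * N)%:R * (mxnorm1 (1%:M : 'M[C]_N) * w) *
    (eta + (1 + (4 * eta)^-1) * (1 + 1 - 2)).
    apply: cvgMr; apply: cvgD; first exact: cvg_cst.
    apply: cvgMr; apply: cvgB; last exact: cvg_cst.
    by apply: cvgD; [exact: gint_ratio_up|exact: gint_ratio_down].
  apply: (cvgr_to_ge lim); apply: nearW => m.
  exact: (mmoment_normalized_le hA Ak eta0 (WA (m + k).+1)).
have : w <= w * (D * eta).
  apply: (le_trans wle); rewrite le_eqVlt; apply/orP; left; apply/eqP.
  by rewrite /D; ring.
have : D * eta <= 1 / 2.
  rewrite /eta ler_pdivrMr//; lra.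
move=> h1 h2; apply/eqP; rewrite eq_le w0 andbT.
have : w * (D * eta) <= w * (1 / 2) by rewrite ler_wpM2l.
lra.
Qed.

Lemma Gamma_unit A : Re_pos A -> Gamma A \in unitmx.
Proof.
move=> hA; rewrite -row_free_unit -kermx_eq0; apply/eqP.
apply: (mmoment_separating hA) => n.
(* The moment of order n is (A)_n Gamma(A); its factors are interchanged to bring Gamma(A) next to
   its left kernel. *)
rewrite mmoment_poch// -scalemxAr (comm_mx_mmoment hA (lexx 0) ltr01 (comm_mx_sym _)).
  by rewrite mulmxA -GammaE// mulmx_ker mul0mx scaler0.
exact: comm_mx_poch.
Qed.

End GammaInvertible.

(** * Abel summation and the Gamma transform of a power series *)

Section PochBounds.
Variables (R : realType) (N : nat).
Local Notation C := (Cplx R).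
Implicit Types (A M W : 'M[C]_N).

Lemma Re_pos_shift_unit A n : Re_pos A -> A + (n%:R)%:M \in unitmx.
Proof.
move=> hA; rewrite -row_free_unit -kermx_eq0; apply/negPn/negP => h.
have : eigenvalue A (- n%:R : C) by rewrite /eigenvalue /eigenspace raddfN opprK.
move/hA; rewrite -RtoC_nat -RtoCN /= oppr_gt0 => n0.
by have := lt_le_trans n0 (ler0n R n); rewrite ltxx.
Qed.

Lemma poch_unit A l : Re_pos A -> poch A l \in unitmx.
Proof.
move=> hA; elim: l => [|l IH].
  have -> : poch A 0 = 1%:M by rewrite /poch big_ord0.
  exact: unitmx1.
by rewrite poch_recr unitmx_mul IH Re_pos_shift_unit.
Qed.

(** With a the norm of A, |(A + kI) u| >= (k - a) |u|, and k + 1 <= (1 + q)(k - a) for all large k.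
    Beyond index k0, each factor of (A)_l thus loses at most 1 + q against the matching factor of
    l!. *)
Lemma mxnorm1_poch_ge A (q : R) : 0 < q -> exists k0 : nat, forall m M,
  mxnorm1 (poch A k0 *m M) * (k0 + m)`!%:R <=
  k0`!%:R * (1 + q) ^+ m * mxnorm1 (poch A (k0 + m) *m M).
Proof.
move=> q0; set a := mxnorm1 A.
have a0 : 0 <= a by exact: mxnorm1_ge0.
have h0 : 0 <= (1 + a * (1 + q)) / q.
  by rewrite divr_ge0 ?(ltW q0)// addr_ge0// mulr_ge0// addr_ge0// ltW.
(* The condition k + 1 <= (1 + q)(k - a) rewritten as 1 + a (1 + q) <= k q. *)
have [k0 hk0] : exists k0 : nat, (1 + a * (1 + q)) / q <= k0%:R.
  by exists (Num.bound ((1 + a * (1 + q)) / q)); exact: ltW (archi_boundP h0).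
exists k0; elim=> [|m IH] M; first by rewrite addn0 expr0 mulr1 mulrC.
set k := (k0 + m)%N in IH *; rewrite addnS -/k.
set u := poch A k *m M.
have uE : poch A k.+1 *m M = (A + (k%:R)%:M) *m u.
  rewrite /u poch_recr mulmxA; congr (_ *m _); apply/esym; apply: comm_mx_poch.
  by apply: comm_mx_sym; apply: comm_mxD => //; exact: comm_mx_scalar.
have uk : k%:R * mxnorm1 u <= mxnorm1 ((A + (k%:R)%:M) *m u) + a * mxnorm1 u.
  have -> : k%:R * mxnorm1 u = mxnorm1 ((A + (k%:R)%:M) *m u - A *m u).
    rewrite mulmxDl mul_scalar_mx addrAC subrr add0r -RtoC_nat mxnorm1ZR.
    by rewrite normr_nat.
  by apply: (le_trans (mxnorm1B _ _)); rewrite lerD2l mxnorm1M.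
have hk : k.+1%:R <= (1 + q) * (k%:R - a).
  have : (1 + a * (1 + q)) <= k%:R * q.
    rewrite -ler_pdivrMr//; apply: (le_trans hk0).
    by rewrite ler_nat leq_addr.
  by rewrite -natr1; lra.
rewrite uE factS natrM mulrCA.
apply: (le_trans (ler_wpM2l _ (IH M))) => //.
rewrite -/u exprS.
have -> : k.+1%:R * (k0`!%:R * (1 + q) ^+ m * mxnorm1 u) =
   (k0`!%:R * (1 + q) ^+ m) * (k.+1%:R * mxnorm1 u) by ring.
have -> : k0`!%:R * ((1 + q) * (1 + q) ^+ m) * mxnorm1 ((A + (k%:R)%:M) *m u) =
   (k0`!%:R * (1 + q) ^+ m) * ((1 + q) * mxnorm1 ((A + (k%:R)%:M) *m u)) by ring.
have q1 : 0 <= 1 + q by rewrite addr_ge0// ltW.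
apply: ler_wpM2l; first by rewrite mulr_ge0// exprn_ge0.
apply: (@le_trans _ _ ((1 + q) * (k%:R - a) * mxnorm1 u)).
  by rewrite ler_wpM2r// mxnorm1_ge0.
by rewrite -mulrA ler_wpM2l// mulrBl lerBlDr.
Qed.

Lemma poch_coef_bound A (D : nat -> 'M[C]_N) (c q : R) : Re_pos A ->
  (forall l, mxnorm1 (poch A l *m D l) <= c) -> 0 < q ->
  exists2 K : R, 0 <= K & forall l, mxnorm1 (D l) <= K * ((1 + q) ^+ l / l`!%:R).
Proof.
move=> hA hc q0; have [k0 hk0] := mxnorm1_poch_ge A q0.
have c0 : 0 <= c by apply: le_trans (mxnorm1_ge0 _) (hc 0%N).
set nu := mxnorm1 (invmx (poch A k0)).
have nu0 : 0 <= nu by exact: mxnorm1_ge0.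
(* [K1] serves l >= k0, where the factor (A)_k0 is removed by its inverse; [K2] absorbs the finitely
   many l < k0. *)
pose K1 := nu * k0`!%:R * c; pose K2 := \sum_(l < k0) mxnorm1 (D l) * l`!%:R.
have K10 : 0 <= K1 by rewrite !mulr_ge0.
have K20 : 0 <= K2 by apply: sumr_ge0 => l _; rewrite mulr_ge0// mxnorm1_ge0.
have f0 l : 0 < l`!%:R :> R by rewrite ltr0n fact_gt0.
have q1 l : 1 <= (1 + q) ^+ l by rewrite exprn_ege1// lerDl ltW.
exists (K1 + K2); first by rewrite addr_ge0.
move=> l; rewrite mulrA ler_pdivlMr//.
have [lk|kl] := ltnP l k0.
  apply: (@le_trans _ _ (K2 * 1)).
    rewrite mulr1 /K2 (bigD1 (Ordinal lk))//= lerDl.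
    by apply: sumr_ge0 => i _; rewrite mulr_ge0// mxnorm1_ge0.
  by apply: ler_pM => //; rewrite lerDr.
have h := hk0 (l - k0)%N (D l); rewrite subnKC// in h.
have h1 : mxnorm1 (D l) <= nu * mxnorm1 (poch A k0 *m D l).
  rewrite -{1}(mulKmx (poch_unit k0 hA) (D l)).
  exact: mxnorm1M.
apply: (@le_trans _ _ (nu * (mxnorm1 (poch A k0 *m D l) * l`!%:R))).
  by rewrite mulrA ler_wpM2r// ltW.
apply: (@le_trans _ _ (nu * (k0`!%:R * (1 + q) ^+ (l - k0) * c))).
  rewrite ler_wpM2l//; apply: (le_trans h).
  by rewrite ler_wpM2l// mulr_ge0// exprn_ge0// addr_ge0// ltW.
rewrite (_ : nu * _ = K1 * (1 + q) ^+ (l - k0)); last by rewrite /K1; ring.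
apply: ler_pM => //; first by rewrite exprn_ge0// addr_ge0// ltW.
  by rewrite lerDl.
by rewrite ler_weXn2l ?leq_subr// lerDl ltW.
Qed.

End PochBounds.

(** * Abel's theorem for series *)

Section AbelSeries.
Variable R : realType.

(** Summation by parts, with the limit subtracted from the partial sums. The index l.+1 appears
    because [series u l] stops before the term [u l]. *)
Lemma Abel_sum_identity (u : nat -> R) (S y : R) (M : nat) :
  series (fun l => y ^+ l * u l) M - S =
  y ^+ M * (series u M - S) + (1 - y) * \sum_(0 <= l < M) y ^+ l * (series u l.+1 - S).
Proof.
elim: M => [|M IH].
  by rewrite /series/= !big_geq// expr0 mulr0 addr0 mul1r.
have E1 : series (fun l => y ^+ l * u l) M.+1 = series (fun l => y ^+ l * u l) M + y ^+ M * u M.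
  by rewrite /series/= big_nat_recr.
have E2 : series u M.+1 = series u M + u M by rewrite /series/= big_nat_recr.
rewrite [in RHS]big_nat_recr//= E1 E2 addrAC IH exprS.
ring.
Qed.

(** One [e] pays for the boundary term, the other for the indices from L on, where (1 - y) times the
    sum of y^l telescopes to at most 1. The remaining sum has fixed length L and is killed by 1 - y
    as y tends to 1. *)
Lemma Abel_sum_le (u : nat -> R) (S y e : R) (L : nat) : 0 < y -> y <= 1 ->
  (forall l, (L <= l)%N -> `|series u l - S| <= e) ->
  forall m, `|series (fun l => y ^+ l * u l) (L + m) - S| <=
    2 * e + (1 - y) * \sum_(0 <= l < L) `|series u l.+1 - S|.
Proof.
move=> y0 y1 hL m; rewrite Abel_sum_identity.
have e0 : 0 <= e by apply: le_trans (hL L _).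
have yn n : 0 <= y ^+ n <= 1 by rewrite exprn_ge0 ?exprn_ile1// ltW.
have h : (1 - y) * \sum_(0 <= l < L + m) y ^+ l * `|series u l.+1 - S| <=
   (1 - y) * (\sum_(0 <= l < L) `|series u l.+1 - S|) + e * (y ^+ L - y ^+ (L + m)).
  elim: m => [|m IH].
    rewrite addn0 subrr mulr0 addr0 ler_wpM2l ?subr_ge0//.
    by apply: ler_sum => l _; have /andP[? ?] := yn l; rewrite ler_piMl.
  rewrite addnS big_nat_recr//= mulrDr.
  have : y ^+ (L + m) * `|series u (L + m).+1 - S| <= y ^+ (L + m) * e.
    have /andP[? ?] := yn (L + m)%N; rewrite ler_wpM2l// hL//.
    by rewrite -addnS leq_addr.
  have y1' : 0 <= 1 - y by rewrite subr_ge0.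
  move=> /(ler_wpM2l y1') h; rewrite exprS; move: IH h; lra.
have h1 : `|y ^+ (L + m) * (series u (L + m)%N - S)| <= e.
  have /andP[? ?] := yn (L + m)%N.
  rewrite normrM ger0_norm// (le_trans (ler_piMl _ _))// hL// leq_addr//.
have h2 : `|(1 - y) * \sum_(0 <= l < L + m) y ^+ l * (series u l.+1 - S)| <=
    (1 - y) * \sum_(0 <= l < L + m) y ^+ l * `|series u l.+1 - S|.
  rewrite normrM ger0_norm ?subr_ge0// ler_wpM2l ?subr_ge0//.
  apply: (le_trans (ler_norm_sum _ _ _)); apply: ler_sum => l _.
  by have /andP[? ?] := yn l; rewrite normrM (ger0_norm (x := y ^+ l)).
have h3 : e * (y ^+ L - y ^+ (L + m)) <= e.
  have /andP[? ?] := yn (L + m)%N; have /andP[? ?] := yn L.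
  rewrite ler_piMr//; lra.
apply: (le_trans (ler_normD _ _)); move: h h1 h2 h3; lra.
Qed.

Lemma Abel_series (u : nat -> R) (S : R) (y v : nat -> R) :
  series u @ \oo --> S -> (forall n, 0 < y n) -> (forall n, y n <= 1) ->
  y n @[n --> \oo] --> (1 : R) ->
  (forall n, series (fun l => y n ^+ l * u l) @ \oo --> v n) ->
  v n @[n --> \oo] --> S.
Proof.
move=> uS y0 y1 yc hv; apply/cvgrPdist_le => e e0.
have e4 : 0 < e / 4 by rewrite divr_gt0.
move/cvgrPdist_le : (uS) => /(_ _ e4)[L _ hL].
have hL' l : (L <= l)%N -> `|series u l - S| <= e / 4.
  by move=> /hL /=; rewrite distrC.
set W := \sum_(0 <= l < L) `|series u l.+1 - S|.
have W0 : 0 <= W by apply: sumr_ge0 => l _; exact: normr_ge0.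
have hn n : `|v n - S| <= e / 2 + (1 - y n) * W.
  have h : `|series (fun l => y n ^+ l * u l) M - S| @[M --> \oo] --> `|v n - S|.
    by apply: cvg_norm; apply: cvgB; [exact: hv|exact: cvg_cst].
  apply: (cvgr_to_le h); exists L => // M /= LM.
  rewrite -(subnKC LM); apply: (le_trans (Abel_sum_le (y0 n) (y1 n) hL' _)).
  by rewrite lerD2r; lra.
have h : (1 - y n) * W @[n --> \oo] --> 0.
  rewrite -(mul0r W) -(subrr 1); apply: cvgMl; apply: cvgB => //; exact: cvg_cst.
have e2 : 0 < e / 2 by rewrite divr_gt0.
move/cvgrPdist_le : h => /(_ _ e2); apply: filterS => n.
rewrite sub0r normrN distrC => h; apply: (le_trans (hn n)).
have := ler_norm ((1 - y n) * W); move: h; lra.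
Qed.

End AbelSeries.

(** * Exchange of sum and integral, and removal of the regularization *)

Section GammaTransform.
Variables (R : realType) (N : nat).
Local Notation C := (Cplx R).
Local Notation mu := (@lebesgue_measure R).
Local Notation pos := (`]0, +oo[%classic : set R).
Implicit Types (A M W : 'M[C]_N) (D : nat -> 'M[C]_N).

Lemma mx_series_bounded (u : nat -> 'M[C]_N) : cvgn (series u) ->
  exists c : R, forall l, mxnorm1 (u l) <= c.
Proof.
move=> /cvg_series_cvg_0 /mx_cvgP u0.
have h : cvgn (fun l => mxnorm1 (u l)).
  by apply/cvg_ex; exists 0; under eq_fun do rewrite -[u _]subr0.
have [B [_ hB]] := cvg_seq_bounded h.
exists (B + 1) => l; apply: le_trans (ler_norm _) _.
by apply: (hB (B + 1)) => //; rewrite ltrDl.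
Qed.

Lemma mx_integral_series (D0 : set R) (G : nat -> R -> 'M[C]_N) n : measurable D0 ->
  (forall l, mx_integrable D0 (G l)) ->
  mx_integrable D0 (fun t => series (G ^~ t) n) /\
  mx_integral D0 (fun t => series (G ^~ t) n) = series (fun l => mx_integral D0 (G l)) n.
Proof.
move=> mD iG; elim: n => [|n [IH1 IH2]].
  have E : (fun t => series (G ^~ t) 0) = (fun=> 0).
    by apply/funext => t; rewrite /series/= big_geq.
  rewrite E /series/= big_geq//; split.
    apply/mx_integrableP => b i j; under eq_fun do rewrite mxcoord0.
    exact: integrable0.
  apply: mxcoord_ext => b i j.
  by rewrite mxcoord_integral !mxcoord0 Rintegral_cst// mul0r.
have -> : (fun t => series (G ^~ t) n.+1) = (fun t => series (G ^~ t) n + G n t).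
  by apply/funext => t; rewrite /series/= big_nat_recr.
have [j1 j2] := mx_integralD mD IH1 (iG n).
by split => //; rewrite j2 IH2 [in RHS]/series/= big_nat_recr.
Qed.

Section PowerSeries.
Variables (D : nat -> 'M[C]_N) (K rho : R).
Hypotheses (K0 : 0 <= K) (rho0 : 0 <= rho).
Hypothesis hD : forall l, mxnorm1 (D l) <= K * (rho ^+ l / l`!%:R).

Definition mx_pseries (t : R) (l : nat) : 'M[C]_N := RtoC (t ^+ l) *: D l.

Lemma mx_pseries_le (t : R) l : mxnorm1 (mx_pseries t l) <= K * exp_coeff (rho * `|t|) l.
Proof.
rewrite mxnorm1ZR normrX /exp_coeff/= exprMn.
apply: (le_trans (ler_wpM2l _ (hD l))); first by rewrite exprn_ge0.
by rewrite le_eqVlt; apply/orP; left; apply/eqP; ring.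
Qed.

Lemma is_cvg_mx_pseries (t : R) : cvgn (series (mx_pseries t)).
Proof.
apply: (mx_series_cvg (mx_pseries_le t)).
exact: is_cvg_seriesZ (is_cvg_series_exp_coeff _).
Qed.

(** Uniformity in [n] makes this the majorant for dominated convergence of the partial sums. *)
Lemma mx_pseries_partial_le (t : R) n : 0 <= t ->
  mxnorm1 (series (mx_pseries t) n) <= K * expR (rho * t).
Proof.
move=> t0; apply: (le_trans (mxnorm1_sum _ _ _)).
apply: (@le_trans _ _ (K * series (exp_coeff (rho * t)) n)).
  rewrite /series/= mulr_sumr; apply: ler_sum => l _.
  by have := mx_pseries_le t l; rewrite ger0_norm.
rewrite ler_wpM2l// /expR; apply: nondecreasing_cvgn_le; last exact: is_cvg_series_exp_coeff.
by apply: nondecreasing_series => k _ _; rewrite exp_coeff_ge0// mulr_ge0.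
Qed.

(** The coordinates are everywhere convergent power series, hence differentiable. Continuity gives
    measurability of the integrand and the hypothesis of Abel's theorem for integrals. *)
Lemma mx_pseries_continuous (t : R) :
  (fun t => limn (series (mx_pseries t))) @ t --> limn (series (mx_pseries t)).
Proof.
apply/mx_cvg_coord => b i j.
pose c l := mxcoord b i j (D l).
have cE x : mxcoord b i j (limn (series (mx_pseries x))) = limn (pseries c x).
  apply/esym/cvg_lim => //; have := @mx_series_coord _ _ _ b i j (@is_cvg_mx_pseries x).
  by under eq_fun do rewrite /mx_pseries mxcoordZ mulrC.
have cK k : `|c k| <= K * (rho ^+ k / k`!%:R).
  exact: le_trans (normr_mxcoord _ _ _ _) (hD k).
have h : is_derive t 1 (fun x => limn (pseries c x)) (limn (pseries (pseries_diffs c) t)).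
  apply: (@pseries_snd_diffs _ _ (`|t| + 1)).
  - exact: is_cvg_pseries_expbound cK.
  - exact: is_cvg_pseries_expbound (expbound_pseries_diffs cK).
  - exact: is_cvg_pseries_expbound (expbound_pseries_diffs (expbound_pseries_diffs cK)).
  - by rewrite [ltRHS]ger0_norm ?addr_ge0// ltrDl.
rewrite cE; under eq_fun do rewrite cE.
exact: is_derive_continuous h.
Qed.

End PowerSeries.

Lemma mx_Abel_series (u : nat -> 'M[C]_N) (y : nat -> R) :
  cvgn (series u) -> (forall n, 0 < y n) -> (forall n, y n < 1) ->
  y n @[n --> \oo] --> (1 : R) ->
  (forall n, cvgn (series (fun l => RtoC (y n ^+ l) *: u l))) /\
  limn (series (fun l => RtoC (y n ^+ l) *: u l)) @[n --> \oo] --> limn (series u).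
Proof.
move=> cu y0 y1 yc.
have cy n : cvgn (series (fun l => RtoC (y n ^+ l) *: u l)).
  have [c hc] := mx_series_bounded cu.
  apply: (@mx_series_cvg _ _ _ (geometric c (y n))).
    move=> l; rewrite mxnorm1ZR ger0_norm ?exprn_ge0 ?(ltW (y0 n))//.
    by rewrite /geometric/= mulrC ler_wpM2r ?exprn_ge0 ?(ltW (y0 n)).
  by apply: is_cvg_geometric_series; rewrite gtr0_norm.
split => //; apply/mx_cvg_coord => b i j.
apply: (@Abel_series _ (fun l => mxcoord b i j (u l)) _ y) => //.
- exact: mx_series_coord.
- by move=> n; exact: ltW.
- move=> n; have := @mx_series_coord _ _ _ b i j (cy n).
  by under eq_fun do rewrite mxcoordZ.
Qed.

Lemma mker_transform A D (d : R) : Re_pos A -> 0 < d ->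
  (exists c : R, forall l, mxnorm1 (poch A l *m D l) <= c) ->
  mx_integrable pos (fun t => RtoC (expR (- d * t)) *:
      (mker A 0 1 t *m limn (series (mx_pseries D t)))) /\
  (cvgn (series (fun l => RtoC ((1 + d)^-1 ^+ l) *: (poch A l *m D l))) ->
  mx_integral pos (fun t => RtoC (expR (- d * t)) *:
      (mker A 0 1 t *m limn (series (mx_pseries D t)))) =
  mmoment A 0 (1 + d) *m limn (series (fun l => RtoC ((1 + d)^-1 ^+ l) *: (poch A l *m D l)))).
Proof.
move=> hA d0 [c hc].
have pm : measurable pos by exact: measurable_itv.
have d1 : 0 < 1 + d by rewrite addr_gt0.
have d2 : 0 < d / 2 by rewrite divr_gt0.
(* With q = d/2 the partial sums are O(e^((1+d/2)t)); multiplied by e^(-(1+d)t) they leave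
   e^(-(d/2)t), the decay in the majorant [g]. *)
have [K K0 hK] := poch_coef_bound hA hc d2.
have rho0 : 0 <= 1 + d / 2 by rewrite addr_ge0// ltW.
have [Kg [p [p' [Kg0 p0 p'0 hKg]]]] := mker_norm_le hA.
pose g t := K * Kg * (gker p (d / 2) t + gker p' (d / 2) t).
have ig : mu.-integrable pos (EFin \o g) by exact: integrable_gker_add.
pose F n t := RtoC (expR (- d * t)) *: (mker A 0 1 t *m series (mx_pseries D t) n).
have FE n : {in pos, F n =1 (fun t => series (fun l => mker A l%:R (1 + d) t *m D l) n)}.
  move=> t; rewrite inE/= in_itv/= andbT => t0.
  rewrite /F /series/= mulmx_sumr scaler_sumr; apply: eq_bigr => l _.
  rewrite /mx_pseries -scalemxAr !scalemxAl scalerA mulrC -scalerA mkerXM//.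
  by rewrite addr0 addrC.
have iml l : mx_integrable pos (fun t => mker A l%:R (1 + d) t *m D l).
  by apply: (proj1 (mx_integral_mulr _ _ _)) => //; exact: mx_integrable_mker.
have iF n : mx_integrable pos (F n).
  apply: (eq_mx_integrable pm (F := fun t => series (fun l => mker A l%:R (1 + d) t *m D l) n)).
    by move=> t tpos; rewrite FE.
  by have [] := mx_integral_series n pm iml.
have IF n : mx_integral pos (F n) = mmoment A 0 (1 + d) *m
    series (fun l => RtoC ((1 + d)^-1 ^+ l) *: (poch A l *m D l)) n.
  rewrite (eq_mx_integral (FE n)) (proj2 (mx_integral_series n pm iml)).
  rewrite /series/= mulmx_sumr; apply: eq_bigr => l _.
  rewrite (proj2 (mx_integral_mulr _ pm (mx_integrable_mker hA (ler0n _ l) d1))).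
  rewrite -/(mmoment A l%:R (1 + d)) mmoment_poch// -scalemxAl -scalemxAr mulmxA.
  congr (_ *: (_ *m _)); apply: comm_mx_mmoment => //.
  by apply: comm_mx_sym; exact: comm_mx_poch.
have [h1 h2] : mx_integrable pos (fun t => RtoC (expR (- d * t)) *:
      (mker A 0 1 t *m limn (series (mx_pseries D t)))) /\
   mx_integral pos (F n) @[n --> \oo] --> mx_integral pos (fun t => RtoC (expR (- d * t)) *:
      (mker A 0 1 t *m limn (series (mx_pseries D t)))).
  apply: (mx_dominated_cvg pm _ _ _ ig).
  - by move=> n; exact: mx_integrable_measurable (iF n).
  - apply: mx_continuous_measurable => // t t0; apply: mx_cvgZ.
      apply: continuous_comp; last exact: continuous_expR.
      by apply: cvgMr; exact: cvg_id.
    apply: mx_cvgM; first exact: mker_cvg.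
    exact: (mx_pseries_continuous hK).
  - move=> t _; apply: mx_cvgZ; first exact: cvg_cst.
    apply: mx_cvg_mull; exact: (is_cvg_mx_pseries hK).
  - move=> n t /=; rewrite in_itv/= andbT => t0.
    rewrite mxnorm1ZR ger0_norm ?expR_ge0//.
    apply: (le_trans (ler_wpM2l (expR_ge0 _) (mxnorm1M _ _))).
    have hs := mx_pseries_partial_le K0 rho0 hK n (ltW t0).
    apply: (@le_trans _ _ (expR (- d * t) *
       ((Kg * (gker (0 + p) 1 t + gker (0 + p') 1 t)) * (K * expR ((1 + d / 2) * t))))).
      rewrite ler_wpM2l ?expR_ge0//; apply: ler_pM => //; [exact: mxnorm1_ge0|exact: mxnorm1_ge0|].
      exact: hKg.
    have E a : expR (- d * t) * expR ((1 + d / 2) * t) * gker (0 + a) 1 t = gker a (d / 2) t.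
      rewrite -expRD.
      have -> : - d * t + (1 + d / 2) * t = 0 * ln t - (d / 2 - 1) * t by field.
      by rewrite gkerM !add0r subrK.
    by rewrite /g -!E le_eqVlt; apply/orP; left; apply/eqP; ring.
split => // cS; apply: mx_cvg_unique h2 _.
under eq_fun do rewrite IF.
exact: mx_cvg_mull.
Qed.

Lemma gamma_transform A D : Re_pos A ->
  cvgn (series (fun l => poch A l *m D l)) ->
  cvg_integral_pinfty 0 (fun t => gamma_kernel A t *m limn (series (mx_pseries D t))) ->
  limn (series (fun l => poch A l *m D l)) =
  invmx (Gamma A) *m
    integral_pinfty 0 (fun t => gamma_kernel A t *m limn (series (mx_pseries D t))).
Proof.
move=> hA cS [iT cI].
have bnd := mx_series_bounded cS; have [c hc] := bnd.
(* Here the bound serves only the continuity of the sum, for which any q, such as 1, will do. *)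
have [K K0 hK] := poch_coef_bound hA hc ltr01.
(* [mker] agrees with [gamma_kernel] for t > 0, hence on every domain of integration, and is the
   form for which continuity and moments are established. *)
pose phi t := mker A 0 1 t *m limn (series (mx_pseries D t)).
set I := integral_pinfty _ _; set S := limn _.
have phiE T : {in `]0, T]%classic, phi =1
    (fun t => gamma_kernel A t *m limn (series (mx_pseries D t)))}.
  by move=> t; rewrite inE/= in_itv/= => /andP[t0 _]; rewrite /phi gamma_kernelE.
have phiI : mx_integral `]0, T] phi @[T --> +oo] --> I.
  have -> : (fun T => mx_integral `]0, T] phi) = (fun T => mx_integral `]0, T]
      (fun t => gamma_kernel A t *m limn (series (mx_pseries D t)))).
    by apply/funext => T; exact: eq_mx_integral (phiE T).
  exact: cI.
have iphi (T : R) : mx_integrable `]0, T] phi.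
  exact: (eq_mx_integrable (measurable_itv _) (fun t tT => esym (phiE T t tT)) (iT T)).
have cphi (t : R) : 0 < t -> phi @ t --> phi t.
  move=> t0; apply: mx_cvgM; first exact: mker_cvg.
  exact: (mx_pseries_continuous hK).
pose d (n : nat) : R := n.+1%:R^-1.
have d0 n : 0 < d n by rewrite invr_gt0.
have dc : d n @[n --> \oo] --> (0 : R) by exact: cvg_harmonic.
pose y n := (1 + d n)^-1.
have y0 n : 0 < y n by rewrite invr_gt0 addr_gt0.
have y1 n : y n < 1 by rewrite invf_lt1 ?addr_gt0// ltrDl.
have yc : y n @[n --> \oo] --> (1 : R).
  rewrite -[X in _ --> X]invr1; apply: cvgV; first by [].
  by rewrite -[X in _ --> X]addr0; apply: cvgD => //; exact: cvg_cst.
have [cy yS] := mx_Abel_series cS y0 y1 yc.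
have tr n := mker_transform hA (d0 n) bnd.
have hI : mx_integral pos (fun t => RtoC (expR (- d n * t)) *: phi t) @[n --> \oo] --> I.
  by apply: mx_Abel_integral => // n; case: (tr n).
have mE n : {in pos, mker A 0 (1 + d n) =1
    (fun t => RtoC (expR (- d n * t)) *: mker A 0 1 t)}.
  move=> t; rewrite inE/= in_itv/= andbT => t0.
  by have := mkerXM A 0 1 (d n) 0 t0; rewrite expr0 scale1r => ->; rewrite addr0 addrC.
have i1 := mx_integrable_mker hA (lexx 0) ltr01.
have hG : mmoment A 0 (1 + d n) @[n --> \oo] --> Gamma A.
  have -> : (fun n => mmoment A 0 (1 + d n)) =
      (fun n => mx_integral pos (fun t => RtoC (expR (- d n * t)) *: mker A 0 1 t)).
    by apply/funext => n; exact: eq_mx_integral (mE n).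
  apply: (mx_Abel_integral _ _ _ d0 dc).
  - by move=> t t0; exact: mker_cvg.
  - move=> T; apply/mx_integrableP => b i j; apply: integrable_pos_itv.
    by move/mx_integrableP : i1; exact.
  - rewrite (GammaE hA); exact: (mx_integral_pinfty_cvg i1).
  - move=> n; apply: (eq_mx_integrable (measurable_itv _) (mE n)).
    by apply: mx_integrable_mker => //; rewrite addr_gt0.
have hI' : mx_integral pos (fun t => RtoC (expR (- d n * t)) *: phi t) @[n --> \oo]
    --> Gamma A *m S.
  have -> : (fun n => mx_integral pos (fun t => RtoC (expR (- d n * t)) *: phi t)) =
      (fun n => mmoment A 0 (1 + d n) *m
        limn (series (fun l => RtoC (y n ^+ l) *: (poch A l *m D l)))).
    by apply/funext => n; apply: (proj2 (tr n)); exact: cy.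
  exact: (mx_cvgM hG yS).
by rewrite (mx_cvg_unique hI hI') (mulKmx (Gamma_unit hA)).
Qed.

End GammaTransform.

(** * The integral representations of both incomplete exponential functions *)

Theorem theorem3p14 (R : realType) (N r s : nat)
    (A : 'I_r.+1 -> 'M[Cplx R]_N) (B : 'I_s -> 'M[Cplx R]_N)
    (P Q : 'M[Cplx R]_N) (x : R) (z : Cplx R)
    (hcomm : {in P :: Q :: codom A ++ codom B &,
                forall M M' : 'M[Cplx R]_N, comm_mx M M'})
    (hP : Re_pos P) (hQ : Re_pos Q)
    (hA : forall i, Re_pos (A i)) (hB : forall j, Re_pos (B j))
    (hx : 0 < x) :
  (cvgn (series (e_term A B P Q x z)) ->
   (forall t : R, 0 < t ->
      cvgn (series (e_term (tail_family A) B P Q x (z * RtoC t)))) ->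
   cvg_integral_pinfty 0 (fun t =>
      gamma_kernel (A ord0) t *m inc_e (tail_family A) B P Q x (z * RtoC t)) ->
   inc_e A B P Q x z =
   invmx (Gamma (A ord0)) *m integral_pinfty 0 (fun t =>
      gamma_kernel (A ord0) t *m inc_e (tail_family A) B P Q x (z * RtoC t)))
  /\
  (cvgn (series (E_term A B P Q x z)) ->
   (forall t : R, 0 < t ->
      cvgn (series (E_term (tail_family A) B P Q x (z * RtoC t)))) ->
   cvg_integral_pinfty 0 (fun t =>
      gamma_kernel (A ord0) t *m inc_E (tail_family A) B P Q x (z * RtoC t)) ->
   inc_E A B P Q x z =
   invmx (Gamma (A ord0)) *m integral_pinfty 0 (fun t =>
      gamma_kernel (A ord0) t *m inc_E (tail_family A) B P Q x (z * RtoC t))).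
Proof.
have coefE l : hyp_coef A B z l = poch (A ord0) l *m hyp_coef (tail_family A) B z l.
  by rewrite /hyp_coef big_ord_recl -scalemxAr mulmxA.
have coefX t l : hyp_coef (tail_family A) B (z * RtoC t) l =
    RtoC (t ^+ l) *: hyp_coef (tail_family A) B z l.
  by rewrite /hyp_coef exprMn scalerA RtoCX mulrCA mulrA.
(* The shapes of [F] and [G] are premises so that one statement serves both families. [D] will be
   the terms of order r - 1 at [z], which carry the incomplete Gamma quotient as a right factor. *)
have transform D F G : F = (fun l => poch (A ord0) l *m D l) ->
    G = mx_pseries D -> cvgn (series F) ->
    cvg_integral_pinfty 0 (fun t => gamma_kernel (A ord0) t *m limn (series (G t))) ->
    limn (series F) = invmx (Gamma (A ord0)) *m
      integral_pinfty 0 (fun t => gamma_kernel (A ord0) t *m limn (series (G t))).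
  by move=> -> ->; exact: (gamma_transform (hA ord0)).
split=> cS _.
- apply: (transform (e_term (tail_family A) B P Q x z) _
    (fun t => e_term (tail_family A) B P Q x (z * RtoC t)) _ _ cS).
  + by apply/funext => l; rewrite /e_term coefE !mulmxA.
  + by apply/funext => t; apply/funext => l; rewrite /mx_pseries /e_term coefX -!scalemxAl.
- apply: (transform (E_term (tail_family A) B P Q x z) _
    (fun t => E_term (tail_family A) B P Q x (z * RtoC t)) _ _ cS).
  + by apply/funext => l; rewrite /E_term coefE !mulmxA.
  + by apply/funext => t; apply/funext => l; rewrite /mx_pseries /E_term coefX -!scalemxAl.
Qed.
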